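(* Let $n,k$ be integers with $1\le k\le n$. Suppose $\mathcal{P}\subseteq\mathcal{A}(n,k)$ has packing dimension $t>0$, and let $s>0$. For each $P\in\mathcal{P}$ let $P'\subseteq P$ be a subset of Hausdorff dimension at least $s$, and let $F=\bigcup_{P\in\mathcal{P}}P'$. Then $$\dim_P(F)\ \ge\ s+\frac{t-(k-\lceil s\rceil)(n-k)}{\lceil s\rceil+1}.$$ In particular, the union of a packing dimension $t$ set of $k$-planes has packing dimension at least $\frac{t}{k+1}+k$.
   Context: $\mathcal{A}(n,k)$ denotes the affine Grassmannian, i.e. the set of all affine $k$-planes in $\mathbb{R}^n$. Each $P\in\mathcal{A}(n,k)$ is uniquely written $P=V+t$ with $V$ a $k$-dimensional linear subspace of $\mathbb{R}^n$ and $t\in V^\perp$. The metric on $\mathcal{A}(n,k)$ (with respect to which packing dimension of sets of planes is taken) is $\rho(V_1+t_1,V_2+t_2)=\sup_{|x|=1}|\pi_{V_1}x-\pi_{V_2}x|+|t_1-t_2|$, where $\pi_V$ is the orthogonal projection onto $V$. $\dim_P$ denotes packing dimension. *)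

(* Defs.v *)
From HB Require Import structures.
From mathcomp Require Import all_boot all_order all_algebra.
From mathcomp Require Import all_classical all_reals all_analysis.

Set Implicit Arguments.
Unset Strict Implicit.
Unset Printing Implicit Defensive.

Import Order.TTheory GRing.Theory Num.Theory.

Local Open Scope classical_set_scope.
Local Open Scope ring_scope.

(* The metric is an explicit argument [d], because the canonical norm of
   ['rV[R]_n] in the library is the sup norm, not the Euclidean one. *)
Section FractalDimensions.
Context {R : realType} {T : Type}.
Variable d : T -> T -> R.
Implicit Types (A U : set T) (s delta : R).

Definition cball (x : T) (r : R) : set T := [set y | d x y <= r].

(* The diameter of [set0] is [-oo], and [poweR -oo s = 0] for [s != 0], so
   empty members of a cover contribute nothing to the sums below. *)
Definition diameter U : \bar R :=
  ereal_sup [set (d xy.1 xy.2)%:E | xy in U `*` U].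

Definition hausdorff_content s delta A : \bar R :=
  ereal_inf [set (\sum_(i <oo) poweR (diameter (U i)) s)%E | U in
    [set U : nat -> set T | A `<=` \bigcup_i U i /\
       forall i, (diameter (U i) <= delta%:E)%E]].

(* The content increases as [delta] decreases to 0: the supremum is the limit. *)
Definition hausdorff_measure s A : \bar R :=
  ereal_sup [set hausdorff_content s delta A | delta in [set delta | 0 < delta]].

(* Only [s > 0] is considered, which avoids the convention for [0 `^ 0] and
   does not change the infimum; the dimension of [set0] is 0. *)
Definition hausdorff_dim A : \bar R :=
  ereal_inf [set s%:E | s in [set s | 0 < s /\ hausdorff_measure s A = 0%E]].

(* Packings are finite or countable; [D] is the index set. *)
Definition is_packing delta A (D : set nat) (c : nat -> T) (r : nat -> R) :=
  (forall i, D i -> [/\ A (c i), 0 < r i & r i <= delta]) /\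
  trivIset D (fun i => cball (c i) (r i)).

(* A ball is measured by [2 * r], which is its diameter in R^n but may exceed
   it in a general metric space. *)
Definition packing_content s delta A : \bar R :=
  ereal_sup [set v | exists D c r, is_packing delta A D c r /\
    v = (\esum_(i in D) ((2 * r i) `^ s)%:E)%E].

Definition packing_premeasure s A : \bar R :=
  ereal_inf [set packing_content s delta A | delta in [set delta | 0 < delta]].

(* The premeasure is not countably subadditive, hence this second step. *)
Definition packing_measure s A : \bar R :=
  ereal_inf [set (\sum_(i <oo) packing_premeasure s (E i))%E | E in
    [set E : nat -> set T | A `<=` \bigcup_i E i]].

Definition packing_dim A : \bar R :=
  ereal_inf [set s%:E | s in [set s | 0 < s /\ packing_measure s A = 0%E]].

End FractalDimensions.

Section EuclideanSpace.
Context {R : realType} {n : nat}.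
Implicit Types (x y u v : 'rV[R]_n) (V W : {vspace 'rV[R]_n}).

Definition dotp u v : R := \sum_i u 0 i * v 0 i.

Definition enorm x : R := Num.sqrt (dotp x x).

Definition euclidean_dist x y : R := enorm (x - y).

(* Well defined by [orthoprojP] and [orthoproj_unique] below. *)
Definition orthoproj V x : 'rV[R]_n :=
  xget 0 [set y | y \in V /\ forall v, v \in V -> dotp (x - y) v = 0].

Lemma dotpE u v : dotp u v = (u *m v^T) 0 0.
Proof. by rewrite mxE; apply: eq_bigr => i _; rewrite mxE. Qed.

Lemma dotpBl u v w : dotp (u - v) w = dotp u w - dotp v w.
Proof. by rewrite !dotpE mulmxBl !mxE. Qed.

Lemma dotpp_eq0 x : dotp x x = 0 -> x = 0.
Proof.
move/psumr_eq0P => x0; apply/rowP => i; rewrite mxE; apply/eqP.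
by rewrite -sqrf_eq0 expr2 x0 // => j _; rewrite -expr2 sqr_ge0.
Qed.

Lemma orthoproj_unique V x y y' :
  y \in V -> (forall v, v \in V -> dotp (x - y) v = 0) ->
  y' \in V -> (forall v, v \in V -> dotp (x - y') v = 0) -> y = y'.
Proof.
move=> yV yP y'V y'P; apply/eqP; rewrite -subr_eq0; apply/eqP/dotpp_eq0.
have yy'V : y - y' \in V by rewrite rpredB.
have -> : dotp (y - y') (y - y') = dotp ((x - y') - (x - y)) (y - y').
  by congr dotp; rewrite [in RHS]opprB [in RHS]addrC addrA subrK.
by rewrite dotpBl y'P // yP // subrr.
Qed.

Lemma orthoproj_exists V x :
  exists y, y \in V /\ forall v, v \in V -> dotp (x - y) v = 0.
Proof.
pose b := vbasis V.
pose A : 'M[R]_(\dim V, n) := \matrix_i b`_i.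
have AV (u : 'rV_(\dim V)) : u *m A = \sum_i u 0 i *: b`_i.
  by rewrite mulmx_sum_row; apply: eq_bigr => i _; rewrite rowK.
have uAV (u : 'rV_(\dim V)) : u *m A \in V.
  rewrite AV; apply: rpred_sum => i _.
  by rewrite rpredZ// vbasis_mem// mem_nth// size_tuple.
have VA v : v \in V -> exists u : 'rV_(\dim V), v = u *m A.
  move=> vV; exists (\row_i coord b i v); rewrite AV {1}(coord_vbasis vV).
  by apply: eq_bigr => i _; rewrite mxE.
have A0 (u : 'rV_(\dim V)) : u *m A = 0 -> u = 0.
  rewrite AV => u0; apply/rowP => i; rewrite mxE.
  by have /freeP/(_ (fun i => u 0 i) u0 i) := basis_free (vbasisP V).
have G : A *m A^T \in unitmx.
  rewrite -row_free_unit; apply/row_freeP.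
  have /eqP : kermx (A *m A^T) = 0.
    apply/row_matrixP => i; rewrite row0; apply: A0; apply: dotpp_eq0.
    rewrite dotpE trmx_mul mulmxA -[_ *m A *m _]mulmxA -row_mul mulmx_ker.
    by rewrite row0 mul0mx mxE.
  by rewrite kermx_eq0 => /row_freeP.
exists (x *m A^T *m invmx (A *m A^T) *m A); split=> // v /VA[u ->].
rewrite dotpE trmx_mul mulmxA mulmxBl -[_ *m A *m A^T]mulmxA.
by rewrite mulmxKV // subrr mul0mx mxE.
Qed.

Lemma orthoprojP V x :
  orthoproj V x \in V /\ forall v, v \in V -> dotp (x - orthoproj V x) v = 0.
Proof.
rewrite /orthoproj; case: xgetP => [y _ //|noy].
by have [y /noy] := orthoproj_exists V x.
Qed.

End EuclideanSpace.

(* The affine Grassmannian A(n, k), each plane being given by its unique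
   decomposition [V + t] with [\dim V = k] and [t] orthogonal to [V]; see
   [plane_points_exists] and [plane_points_inj] below. *)
Record affine_plane (R : realType) (n k : nat) := AffinePlane {
  dir : {vspace 'rV[R]_n};
  offset : 'rV[R]_n;
  dim_dir : \dim dir = k;
  offset_ortho : forall v, v \in dir -> dotp offset v = 0 }.

Section AffineGrassmannian.
Context {R : realType} {n k : nat}.
Implicit Types P Q : affine_plane R n k.

Definition plane_points P : set 'rV[R]_n :=
  [set v + offset P | v in [set v | v \in dir P]].

Lemma plane_points_exists (V : {vspace 'rV[R]_n}) a : \dim V = k ->
  exists P, plane_points P = [set v + a | v in [set v | v \in V]].
Proof.
move=> dV; have [pV pP] := orthoprojP V a.
exists (AffinePlane dV pP); rewrite /plane_points/=.
apply/seteqP; split=> _ [v /= vV <-].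
  by exists (v - orthoproj V a); [rewrite /= rpredB|rewrite addrAC addrA].
by exists (v + orthoproj V a); [rewrite /= rpredD|rewrite addrA addrAC addrK].
Qed.

Lemma plane_points_inj : injective plane_points.
Proof.
move=> [V a dV aP] [W b dW bP]; rewrite /plane_points/= => VW.
have [v vV ab] : [set v + a | v in [set v | v \in V]] b.
  by rewrite VW; exists 0; rewrite /= ?mem0v ?add0r.
have [w wW ba] : [set w + b | w in [set w | w \in W]] a.
  by rewrite -VW; exists 0; rewrite /= ?mem0v ?add0r.
have VsubW : (V <= W)%VS.
  apply/subvP => u uV.
  have [u' /= u'W u'E] : [set w + b | w in [set w | w \in W]] (u + a).
    by rewrite -VW; exists u.
  have -> : u = u' - w by apply: (addIr a); rewrite -u'E -ba addrA subrK.
  by rewrite rpredB.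
have eVW : V = W by apply/eqP; rewrite eqEdim VsubW dV dW leqnn.
subst W; have eab : a = b.
  apply/eqP; rewrite -subr_eq0; apply/eqP/dotpp_eq0.
  have abV : a - b \in V by rewrite -ba addrK.
  by rewrite dotpBl aP// bP// subrr.
clear v vV ab w wW ba VW; subst b.
by rewrite (Prop_irrelevance dV dW) (Prop_irrelevance aP bP).
Qed.

Definition plane_dist P Q : R :=
  sup [set enorm (orthoproj (dir P) x - orthoproj (dir Q) x) |
        x in [set x | enorm x = 1]]
  + enorm (offset P - offset Q).

End AffineGrassmannian.

(* Main.v *)
(* Suppose [\dim_P F < s + (t - (k - m)(n - k)) / (m + 1)] with [m = ceil s].  Then
   [F] is covered by countably many sets having [eps]-nets of size
   [O(eps^-a)], with [a] still below that bound.  Fix [b1] just below [s] and [b2]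
   just below [k].  By countable subadditivity of the Hausdorff content, [Ps]
   splits into countably many pieces on each of which, for a fixed bounded piece
   [E] of the cover, the sets [part P `&` E] have [b1]-content bounded below, and
   likewise for the [b2]-content of [P] in a fixed ball.

   In such a piece take [N] planes that are [r]-separated and let [eps = c r].
   The set [part P `&` E] needs about [eps^-b1] balls of radius [eps], so by
   pigeonhole a proportion [eps^(a - b1)] of the planes have a point of it near a
   common point of the net.  Doing this [m + 1] times, always away from the affine
   span of the points already chosen (possible since [b1 > m - 1]: a thin
   neighbourhood of that span has small content), and then [k - m] times
   more with points of the whole plane, at the price of a factor [eps^(n - b2)]
   each, the remaining planes have [k + 1] points in general position that agree
   up to [O(eps)].  These planes are then [r]-close to each other, so at most one is
   left and [N = O(r^-((m + 1)(a - b1) + (k - m)(n - b2)))].  The exponent is less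
   than [t], so [\dim_P Ps < t]. *)
Require Import Defs.
From HB Require Import structures.
From mathcomp Require Import all_boot all_order all_algebra.
From mathcomp Require Import all_classical all_reals all_analysis.
From mathcomp Require Import ring lra.

Set Implicit Arguments.
Unset Strict Implicit.
Unset Printing Implicit Defensive.

Import Order.TTheory GRing.Theory Num.Theory.
Local Open Scope classical_set_scope.
Local Open Scope ring_scope.

(** * Euclidean norm *)

Section EuclideanNorm.
Context {R : realType} {n : nat}.
Implicit Types (u v w x y z : 'rV[R]_n) (a : R).

Lemma dotpC u v : dotp u v = dotp v u.
Proof. by apply: eq_bigr => i _; rewrite mulrC. Qed.

Lemma dotpDl u v w : dotp (u + v) w = dotp u w + dotp v w.
Proof. by rewrite !dotpE mulmxDl mxE. Qed.

Lemma dotpZl a u w : dotp (a *: u) w = a * dotp u w.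
Proof. by rewrite !dotpE -scalemxAl mxE. Qed.

Lemma dotp0l w : dotp 0 w = 0.
Proof. by rewrite dotpE mul0mx mxE. Qed.

Lemma dotp_suml I (r : seq I) (P : pred I) (F : I -> 'rV[R]_n) w :
  dotp (\sum_(i <- r | P i) F i) w = \sum_(i <- r | P i) dotp (F i) w.
Proof.
by elim/big_rec2 : _ => [|i x y _ <-]; rewrite ?dotp0l// dotpDl.
Qed.

Lemma dotp_ge0 u : 0 <= dotp u u.
Proof. by apply: sumr_ge0 => i _; rewrite -expr2 sqr_ge0. Qed.

Lemma enorm_ge0 u : 0 <= enorm u. Proof. exact: sqrtr_ge0. Qed.

Lemma sqr_enorm u : enorm u ^+ 2 = dotp u u.
Proof. by rewrite sqr_sqrtr// dotp_ge0. Qed.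

Lemma enorm0 : enorm (0 : 'rV[R]_n) = 0.
Proof. by rewrite /enorm dotp0l sqrtr0. Qed.

Lemma enormZ a u : enorm (a *: u) = `|a| * enorm u.
Proof.
by rewrite /enorm dotpZl dotpC dotpZl mulrA -expr2 sqrtrM ?sqr_ge0// sqrtr_sqr.
Qed.

Lemma enormN u : enorm (- u) = enorm u.
Proof. by rewrite -scaleN1r enormZ normrN1 mul1r. Qed.

Lemma enormBC u v : enorm (u - v) = enorm (v - u).
Proof. by rewrite -enormN opprB. Qed.

(** Cauchy-Schwarz, from the nonnegativity of the squared norm of
    [dotp v v *: u - dotp u v *: v]. *)
Lemma dotp_le u v : `|dotp u v| <= enorm u * enorm v.
Proof.
have key : dotp u v ^+ 2 <= dotp u u * dotp v v.
  have [->|v0] := eqVneq v 0; first by rewrite dotpC !dotp0l mulr0 expr0n.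
  have Dgt : 0 < dotp v v.
    rewrite lt_neqAle dotp_ge0 andbT eq_sym.
    by apply: contra_neq v0 => /dotpp_eq0.
  have := dotp_ge0 (dotp v v *: u - dotp u v *: v).
  rewrite dotpBl !dotpZl (dotpC u) (dotpC v (_ - _)) !dotpBl !dotpZl (dotpC v u).
  set A := dotp u u; set B := dotp u v; set D := dotp v v => H.
  rewrite -subr_ge0 -(pmulr_rge0 _ Dgt) -/D.
  by rewrite (_ : D * _ = D * (D * A - B * B) - B * (D * B - B * D))//; ring.
rewrite -sqrtr_sqr /enorm -sqrtrM ?dotp_ge0//.
by rewrite ler_sqrt// mulr_ge0// dotp_ge0.
Qed.

Lemma ler_enormD u v : enorm (u + v) <= enorm u + enorm v.
Proof.
rewrite -ler_sqr ?nnegrE ?addr_ge0 ?enorm_ge0// sqr_enorm.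
rewrite dotpDl ![dotp _ (_ + _)]dotpC !dotpDl (dotpC v u) -!sqr_enorm.
have := dotp_le u v; rewrite ler_norml => /andP[_].
by move: (dotp u v) (enorm u) (enorm v) => d a b h; nra.
Qed.

Lemma ler_enormB u v : enorm (u - v) <= enorm u + enorm v.
Proof. by rewrite -[in leRHS](enormN v) ler_enormD. Qed.

Lemma ler_enorm_dist z u v : enorm (u - v) <= enorm (u - z) + enorm (z - v).
Proof. by rewrite -[in leLHS](subrK z u) -addrA ler_enormD. Qed.

Lemma ler_enorm_sub u v : `|enorm u - enorm v| <= enorm (u - v).
Proof.
have h x y : enorm x <= enorm (x - y) + enorm y.
  by rewrite -[in leLHS](subrK y x) ler_enormD.
rewrite ler_norml lerBlDr h andbT.
by have := h v u; rewrite enormBC; lra.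
Qed.

Lemma ler_enorm_sum I (r : seq I) (P : pred I) (F : I -> 'rV[R]_n) :
  enorm (\sum_(i <- r | P i) F i) <= \sum_(i <- r | P i) enorm (F i).
Proof.
elim/big_rec2 : _ => [|i x y _ le]; first by rewrite enorm0.
by rewrite (le_trans (ler_enormD _ _))// lerD2l.
Qed.

Lemma coord_le_enorm u i : `|u 0 i| <= enorm u.
Proof.
rewrite -sqrtr_sqr ler_sqrt ?dotp_ge0// /dotp (bigD1 i)//= -expr2 lerDl.
by apply: sumr_ge0 => j _; rewrite -expr2 sqr_ge0.
Qed.

End EuclideanNorm.

(** * Hausdorff content *)

Section HausdorffContent.
Context {R : realType} {T : Type} {d : T -> T -> R}.
Implicit Types (A B U : set T) (s delta e : R).

Lemma diameter_le U e :
  (forall x y, U x -> U y -> d x y <= e) -> (diameter d U <= e%:E)%E.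
Proof.
move=> Ue; apply: ge_ereal_sup => _ [[x y] /= [Ux Uy] <-].
by rewrite lee_fin Ue.
Qed.

Lemma diameter_set0 : diameter d set0 = -oo%E.
Proof.
rewrite /diameter (_ : [set _ | _ in _] = set0) ?ereal_sup0//.
by apply/seteqP; split=> // _ [[x y] [[]]].
Qed.

Lemma le_diameter U x y : U x -> U y -> ((d x y)%:E <= diameter d U)%E.
Proof. by move=> Ux Uy; apply: ereal_sup_ubound; exists (x, y). Qed.

Lemma content_ge0 s delta A : (0 <= hausdorff_content d s delta A)%E.
Proof.
apply: le_ereal_inf_tmp => _ [U _ <-].
by apply: nneseries_ge0 => i _ _; exact: poweR_ge0.
Qed.

Lemma content_mono s delta A B : A `<=` B ->
  (hausdorff_content d s delta A <= hausdorff_content d s delta B)%E.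
Proof.
move=> AB; apply: ereal_inf_le_tmp => _ [U [BU dU] <-].
by exists U => //; split=> //; exact: subset_trans BU.
Qed.

Lemma content0_measure0 s A : 0 < s ->
  hausdorff_content d s 1 A = 0%E -> hausdorff_measure d s A = 0%E.
Proof.
move=> s0 A0; apply/eqP; rewrite eq_le; apply/andP; split; last first.
  apply: (le_trans (content_ge0 s 1 A)); apply: ereal_sup_ubound.
  by exists 1 => //=; exact: ltr01.
apply: ge_ereal_sup => _ [delta /= delta0 <-].
apply/lee_addgt0Pr => e e0; rewrite add0e.
have m0 : 0 < Num.min e (delta `^ s) by rewrite lt_min e0 powR_gt0.
have : (hausdorff_content d s 1 A < (Num.min e (delta `^ s))%:E)%E.
  by rewrite A0 lte_fin.
move=> /ereal_inf_lt[_ [U [AU dU] <-] Ulte].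
apply: (@le_trans _ _ (\sum_(i <oo) poweR (diameter d (U i)) s)%E); last first.
  by apply: (le_trans (ltW Ulte)); rewrite lee_fin ge_min lexx.
apply: ereal_inf_lbound; exists U => //; split=> // i.
have term : (poweR (diameter d (U i)) s < (delta `^ s)%:E)%E.
  apply: (@le_lt_trans _ _ (\sum_(i <oo) poweR (diameter d (U i)) s)%E).
    apply: (le_trans _ (nneseries_lim_ge i.+1 _)) => [|j _ _]; last exact: poweR_ge0.
    rewrite big_nat_recr//= leeDr//.
    by apply: sume_ge0 => j _; exact: poweR_ge0.
  by apply: (lt_le_trans Ulte); rewrite lee_fin ge_min lexx orbT.
move: term (dU i); case: (diameter d (U i)) => [r|_|_ _]; [|by []|exact: leNye].
rewrite /= lte_fin !lee_fin => rd _; rewrite leNgt; apply/negP => dr.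
move: rd; rewrite ltNge ge0_ler_powR ?nnegrE//; try exact: ltW.
by apply: ltW; exact: lt_trans dr.
Qed.

(** The [n]-th set gets a cover of sum at most [e / 2 ^ n.+1]; the double sequence of covers is then
    enumerated along a bijection of [nat] with [nat * nat]. *)
Lemma content0_bigcup s delta (A : nat -> set T) :
  (forall i, hausdorff_content d s delta (A i) = 0%E) ->
  hausdorff_content d s delta (\bigcup_i A i) = 0%E.
Proof.
move=> A0; apply/eqP; rewrite eq_le content_ge0 andbT.
apply/lee_addgt0Pr => e e0; rewrite add0e.
pose P n (U : nat -> set T) := A n `<=` \bigcup_i U i /\
    (forall i, (diameter d (U i) <= delta%:E)%E) /\
    (\sum_(i <oo) poweR (diameter d (U i)) s <= (e / (2 ^ n.+1)%:R)%:E)%E.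
have [G GP] : {G : nat -> nat -> set T & forall n, P n (G n)}.
  apply: (@choice _ _ P) => n.
  have : (hausdorff_content d s delta (A n) < (e / (2 ^ n.+1)%:R)%:E)%E.
    by rewrite A0 lte_fin divr_gt0// ltr0n expn_gt0.
  by move=> /ereal_inf_lt[_ [U [AU dU] <-] Ulte]; exists U; do 2?split=> //; exact: ltW.
pose h (p : nat * nat) := poweR (diameter d (G p.1 p.2)) s.
have h0 p : (0 <= h p)%E by exact: poweR_ge0.
have /card_esym/ppcard_eqP[f] := card_nat2.
apply: (@le_trans _ _ (\sum_(i <oo) h (f i))%E).
  apply: ereal_inf_lbound; exists (fun i => G (f i).1 (f i).2) => //; split.
    move=> x [n _ /((GP n).1)[i _ Gx]]; exists (f^-1%FUN (n, i)) => //=.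
    by rewrite invK ?inE.
  by move=> i; exact: (GP _).2.1.
rewrite nneseries_esumT; last by move=> i; exact: h0.
rewrite -(reindex_esum setT setT f h)//.
have -> : [set: nat * nat] = setT `*`` (fun=> setT) by apply/seteqP; split.
rewrite (_ : esum _ _ = \esum_(n in setT) \esum_(i in setT) h (n, i)); last first.
  by rewrite esum_esum//; apply: eq_esum => -[].
rewrite -nneseries_esumT; last by move=> n; apply: esum_ge0 => i _; exact: h0.
apply: le_trans (epsilon_trick0 xpredT (ltW e0)).
apply: lee_nneseries => [n _ _|n _]; first by apply: esum_ge0 => i _; exact: h0.
by rewrite -nneseries_esumT; [exact: (GP n).2.2|move=> i; exact: h0].
Qed.

Context (d_ge0 : forall x y, 0 <= d x y).

Lemma poweR_diameter_le s U e : 0 < s -> 0 <= e -> (diameter d U <= e%:E)%E ->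
  (poweR (diameter d U) s <= (e `^ s)%:E)%E.
Proof.
move=> s0 e0; have [->|/set0P[x Ux]] := eqVneq U set0.
  by rewrite diameter_set0 poweRNyr ?lee_fin ?powR_ge0// gt_eqF.
have : (0 <= diameter d U)%E.
  by apply: le_trans (le_diameter Ux Ux); rewrite lee_fin.
case: (diameter _ _) => [r| |] //.
by rewrite !lee_fin => r0 re; rewrite ge0_ler_powR ?nnegrE// ltW.
Qed.

(** Each entry pairs a set with a bound on its diameter. The list is continued by [set0], whose
    terms vanish because [s] is positive. *)
Lemma content_le_finite_cover s delta A (p : seq (set T * R)) : 0 < s ->
  A `<=` [set x | exists2 i, (i < size p)%N & (nth (set0, 0%R) p i).1 x] ->
  (forall i, (i < size p)%N -> 0 <= (nth (set0, 0%R) p i).2 <= delta /\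
     (diameter d (nth (set0, 0%R) p i).1 <= (nth (set0, 0%R) p i).2%:E)%E) ->
  (hausdorff_content d s delta A <= (\sum_(q <- p) q.2 `^ s)%:E)%E.
Proof.
move=> s0 Ap pd; pose U i := (nth (set0, 0%R) p i).1.
apply: (@le_trans _ _ (\sum_(i <oo) poweR (diameter d (U i)) s)%E).
  apply: ereal_inf_lbound; exists U => //; split.
    by move=> x /Ap[i ip Ux]; exists i.
  move=> i; have [/pd[/andP[_ de] Ue]|ip] := ltnP i (size p).
    by rewrite (le_trans Ue)// lee_fin.
  by rewrite /U nth_default//= diameter_set0 leNye.
rewrite (nneseries_split 0 (size p)); last by move=> i _; exact: poweR_ge0.
rewrite [X in (_ + X)%E]eseries0 ?adde0; last first.
  move=> i; rewrite add0n => ip _; rewrite /U nth_default//= diameter_set0 poweRNyr//.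
  by rewrite gt_eqF.
rewrite (big_nth (set0, 0%R)) add0n -sumEFin !big_nat; apply: lee_sum => i /= ip.
by have [/andP[e0 _] de] := pd _ ip; exact: poweR_diameter_le.
Qed.

End HausdorffContent.

Lemma hausdorff_dim_content (R : realType) (T : Type) (d : T -> T -> R)
    (s u : R) (A : set T) :
  (s%:E <= hausdorff_dim d A)%E -> 0 < u < s -> hausdorff_content d u 1 A <> 0%E.
Proof.
move=> sA /andP[u0 us] /(content0_measure0 u0) uA.
have : (hausdorff_dim d A <= u%:E)%E by apply: ereal_inf_lbound; exists u.
by move=> /(le_trans sA); rewrite lee_fin leNgt us.
Qed.

(** * Nets and neighbourhoods of affine subspaces *)

Section OrthonormalFrames.
Context {R : realType} {n : nat}.
Implicit Types (u v w x y z : 'rV[R]_n) (e f : nat -> 'rV[R]_n) (j p q : nat).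

(** A frame is a function on [nat] of which only the first [j] values matter, so it is lengthened by
    changing a single value. *)
Definition orthonormal e j :=
  forall p q, (p < j)%N -> (q < j)%N -> dotp (e p) (e q) = (p == q)%:R.

Definition frame_proj e j x : 'rV[R]_n := \sum_(p < j) dotp x (e p) *: e p.

Lemma orthonormal_enorm e j p : orthonormal e j -> (p < j)%N -> enorm (e p) = 1.
Proof. by move=> ej pj; rewrite /enorm ej// eqxx sqrtr1. Qed.

Lemma frame_proj_ortho e j x q : orthonormal e j -> (q < j)%N ->
  dotp (x - frame_proj e j x) (e q) = 0.
Proof.
move=> ej qj; rewrite dotpBl dotp_suml (bigD1 (Ordinal qj))//= dotpZl ej// eqxx.
rewrite mulr1 big1 ?addr0 ?subrr// => p pq.
by rewrite dotpZl ej// (_ : (p == q :> nat) = false) ?mulr0//; exact: negbTE.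
Qed.

(** The coordinates of [x - y] along the frame lie in [[- rho, rho]] and are rounded down to a grid
    of step [eta]. This costs [eta] per coordinate, and the component orthogonal to the frame costs
    one more. *)
Lemma frame_net e j y (rho eta : R) : 0 <= rho -> 0 < eta -> orthonormal e j ->
  exists X : seq 'rV[R]_n, (size X)%:R <= (2 * rho / eta + 1) ^+ j /\
    forall x, enorm (x - y) <= rho ->
      enorm (x - y - frame_proj e j (x - y)) <= eta ->
      exists2 z, z \in X & enorm (x - z) <= j.+1%:R * eta.
Proof.
move=> rho0 eta0 ej; pose N := (Num.truncn (2 * rho / eta)).+1.
have q0 : 0 <= 2 * rho / eta by rewrite divr_ge0 ?mulr_ge0// ltW.
pose pt (g : {ffun 'I_j -> 'I_N}) := y + \sum_p (eta * (g p)%:R - rho) *: e p.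
exists [seq pt g | g <- enum {ffun 'I_j -> 'I_N}]; split.
  rewrite size_map -cardE card_ffun !card_ord natrX lerXn2r ?nnegrE ?addr_ge0//.
  by rewrite /N -natr1 lerD2r truncn_le.
move=> x xrho xeta; set w := x - y in xrho xeta.
pose a p := (dotp w (e p) + rho) / eta.
have dp (p : 'I_j) : - rho <= dotp w (e p) <= rho.
  rewrite -ler_norml (le_trans (dotp_le _ _))//.
  by rewrite (orthonormal_enorm ej)// mulr1.
have a0 (p : 'I_j) : 0 <= a p.
  have /andP[h _] := dp p; rewrite divr_ge0 ?(ltW eta0)//; lra.
have aN (p : 'I_j) : (Num.truncn (a p) < N)%N.
  have /andP[_ h] := dp p; rewrite ltnS; apply: le_truncn.
  by rewrite ler_pM2r ?invr_gt0//; lra.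
pose g : {ffun 'I_j -> 'I_N} := [ffun p : 'I_j => Ordinal (aN p)].
exists (pt g); first by rewrite map_f// mem_enum.
have -> : x - pt g = (w - frame_proj e j w) +
    \sum_(p < j) (dotp w (e p) - (eta * (g p)%:R - rho)) *: e p.
  rewrite /pt opprD addrA -/w -[RHS]addrA; congr (_ + _).
  rewrite /frame_proj -!sumrN -big_split/=; apply: eq_bigr => p _.
  by rewrite [in RHS]scalerBl addrA addNr add0r.
apply: (le_trans (ler_enormD _ _)); rewrite -natr1 mulrDl mul1r addrC lerD//.
apply: (le_trans (ler_enorm_sum _ _ _)).
apply: (@le_trans _ _ (\sum_(p < j) eta)).
  apply: ler_sum => p _; rewrite enormZ (orthonormal_enorm ej)// mulr1 ffunE /=.
  have /andP[lo hi] := truncn_itv (a0 p).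
  move: lo hi; rewrite -natr1 /a ler_pdivlMr// ltr_pdivrMr//.
  set t := _%:R => lo hi; rewrite ler_norml; apply/andP; split; lra.
by rewrite sumr_const card_ord mulr_natl.
Qed.

(** A quantitative form of upper box dimension at most [a]. *)
Definition has_nets (a : R) (A : set 'rV[R]_n) :=
  exists C e0 : R, [/\ 0 < C, 0 < e0 & forall eps, 0 < eps <= e0 ->
    exists X : seq 'rV[R]_n, (size X)%:R <= C * eps `^ (- a) /\
      forall x, A x -> exists2 z, z \in X & enorm (x - z) <= eps].

Lemma orthonormal_std : orthonormal (fun p => \row_(i < n) ((i : nat) == p)%:R) n.
Proof.
move=> p q pn qn; rewrite /dotp (bigD1 (Ordinal pn))//= !mxE eqxx mul1r.
rewrite big1 ?addr0// => i ip.
by rewrite !mxE (_ : (i == p :> nat) = false) ?mul0r//; exact: negbTE.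
Qed.

(** The standard basis is a full frame, so the residual in [frame_net] is zero. *)
Lemma ball_has_nets (M : R) : 0 <= M -> has_nets n%:R [set x | enorm x <= M].
Proof.
move=> M0; pose C := (2 * M * n.+1%:R + 1) ^+ n.
have C0 : 0 < 2 * M * n.+1%:R + 1 by rewrite ltr_wpDl// !mulr_ge0.
exists C, 1; split=> //; first by rewrite exprn_gt0.
move=> eps /andP[eps0 eps1]; pose eta := eps / n.+1%:R.
have eta0 : 0 < eta by rewrite divr_gt0.
have [X [Xs Xn]] := frame_net 0 M0 eta0 orthonormal_std; exists X; split.
  apply: (le_trans Xs); rewrite powRN powR_mulrn ?(ltW eps0)// -exprVn /C -exprMn.
  rewrite lerXn2r ?nnegrE ?addr_ge0 ?divr_ge0 ?mulr_ge0 ?(ltW C0) ?invr_ge0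
    ?(ltW eps0) ?(ltW eta0)//.
  rewrite ler_pdivlMr// mulrDl mul1r /eta invf_div mulrA divfK ?gt_eqF//.
  lra.
move=> x xM; have [||z zX xz] := Xn x; [by rewrite subr0| |].
  rewrite subr0 (_ : x - _ = 0) ?enorm0 ?(ltW eta0)//.
  apply/eqP; rewrite subr_eq0; apply/eqP/rowP => i.
  rewrite summxE (bigD1 i)//= !mxE eqxx.
  rewrite mulr1 big1 ?addr0.
    rewrite /dotp (bigD1 i)//= mxE eqxx mulr1 big1 ?addr0// => l li.
    by rewrite mxE (_ : (l == i :> nat) = false) ?mulr0//; exact: negbTE.
  move=> l li; rewrite !mxE (_ : (i == l :> nat) = false) ?mulr0// eq_sym.
  exact: negbTE.
by exists z => //; rewrite (le_trans xz)// /eta mulrC divfK.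
Qed.

(** A bounded part of the [eta]-neighbourhood of a [j]-dimensional affine subspace is covered by
    [O(eta^-j)] balls of radius [O(eta)]. Their [b]-sum [O(eta^(b - j))] tends to 0 with [eta],
    uniformly in the subspace. *)
Lemma frame_nbhd_small_cover j (b M c : R) : 0 <= M -> j%:R < b -> 0 < c ->
  exists2 eta, 0 < eta & forall e y, orthonormal e j -> enorm y <= M ->
    exists (X : seq 'rV[R]_n) (r : R),
      [/\ 0 <= r, 2 * r <= 1, (size X)%:R * (2 * r) `^ b <= c &
       forall x, enorm x <= M -> enorm (x - y - frame_proj e j (x - y)) <= eta ->
       exists2 z, z \in X & enorm (x - z) <= r].
Proof.
move=> M0 jb c0.
have C0 : 0 < 4 * M + 1 :> R by lra.
pose K := (4 * M + 1) ^+ j * (2 * j.+1%:R) `^ b.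
have K0 : 0 < K by rewrite mulr_gt0 ?exprn_gt0// powR_gt0// mulr_gt0.
have bj : 0 < b - j%:R by rewrite subr_gt0.
pose eta := Num.min (2 * j.+1%:R)^-1 ((c / K) `^ (b - j%:R)^-1).
have eta0 : 0 < eta by rewrite lt_min invr_gt0 mulr_gt0// powR_gt0// divr_gt0.
have etaj : eta <= (2 * j.+1%:R)^-1 by rewrite ge_min lexx.
have eta1 : eta <= 1.
  apply: (le_trans etaj); rewrite invf_le1 ?mulr_gt0//.
  have : 1 <= j.+1%:R :> R by rewrite ler1n.
  lra.
have etac : eta `^ (b - j%:R) <= c / K.
  have -> : c / K = ((c / K) `^ (b - j%:R)^-1) `^ (b - j%:R).
    by rewrite -powRrM mulVf ?gt_eqF// powRr1// ltW// divr_gt0.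
  rewrite ge0_ler_powR ?nnegrE ?powR_ge0 ?(ltW bj) ?(ltW eta0)//.
  by rewrite ge_min lexx orbT.
exists eta => // e y ej yM.
have M20 : 0 <= 2 * M by lra.
have [X [Xs Xn]] := frame_net y M20 eta0 ej.
exists X, (j.+1%:R * eta); split.
- by rewrite mulr_ge0// ltW.
- by rewrite mulrA mulrC -ler_pdivlMr ?mulr_gt0// mul1r.
- have -> : c = K * (c / K) by rewrite mulrC divfK// gt_eqF.
  apply: le_trans (ler_wpM2l (ltW K0) etac).
  rewrite mulrA powRM ?mulr_ge0 ?(ltW eta0)// mulrA /K.
  rewrite powRB ?gt_eqF ?implybT// powR_mulrn ?(ltW eta0)//.
  rewrite (_ : (4 * M + 1) ^+ j * (2 * j.+1%:R) `^ b * (eta `^ b / eta ^+ j) =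
    ((4 * M + 1) / eta) ^+ j * (2 * j.+1%:R) `^ b * eta `^ b); last first.
    by rewrite expr_div_n; ring.
  rewrite ler_wpM2r ?powR_ge0// ler_wpM2r ?powR_ge0// (le_trans Xs)//.
  rewrite lerXn2r ?nnegrE ?addr_ge0 ?divr_ge0 ?mulr_ge0 ?(ltW C0) ?(ltW eta0)//.
  rewrite ler_pdivlMr// mulrDl divfK ?gt_eqF//; lra.
- move=> x xM; apply: Xn; rewrite (le_trans (ler_enormB _ _))//; lra.
Qed.

End OrthonormalFrames.

(** * Hausdorff content of planes *)

Section CubeCover.
Import numFieldNormedType.Exports.
Context {R : realType}.

Lemma card_ord_interval (L : nat) (x y : R) : 0 <= y ->
  #|[pred a : 'I_L | `|a%:R - x| < y]|%:R <= 2 * y + 1.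
Proof.
move=> y0; set S := [pred a : 'I_L | _].
have [a1 Sa1|S0] := pickP S; last first.
  by rewrite eq_card0// addr_ge0// mulr_ge0.
pose a0 := [arg min_(i < a1 in S) (i : nat)].
have [Sa0 a0min] : S a0 /\ forall a, S a -> (a0 <= a)%N.
  by rewrite /a0; case: arg_minnP => // i Si h; split=> // a /h.
pose N := Num.truncn (2 * y).
apply: (@le_trans _ _ N.+1%:R); last first.
  by rewrite -natr1 lerD2r truncn_le ?mulr_ge0.
rewrite ler_nat cardE -(size_map (@nat_of_ord L)) -[N.+1](size_iota a0).
apply: uniq_leq_size; first by rewrite map_inj_uniq ?enum_uniq//; exact: ord_inj.
move=> _ /mapP[a + ->]; rewrite mem_enum mem_iota => Sa.
rewrite a0min//= -ltn_subLR ?a0min// ltnS.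
rewrite -(natrK (R := R) (a - a0)%N); apply: le_truncn; rewrite natrB ?a0min//.
move: Sa Sa0; rewrite /S/= unfold_in/= !ltr_norml => /andP[_ h1] /andP[h2 _].
lra.
Qed.

Lemma card_ffun_cube (k L : nat) (x : 'I_k -> R) (y : R) : 0 <= y ->
  #|[pred g : {ffun 'I_k -> 'I_L} | [forall j, `|(g j)%:R - x j| < y]]|%:R
    <= (2 * y + 1) ^+ k.
Proof.
move=> y0; pose F j : pred 'I_L := [pred a : 'I_L | `|a%:R - x j| < y].
have -> : #|[pred g : {ffun 'I_k -> 'I_L} | [forall j, `|(g j)%:R - x j| < y]]| =
    (\prod_j #|F j|)%N.
  transitivity #|(family F : simpl_pred {dffun forall _, 'I_L})|.
    by apply: eq_card => g; rewrite !inE.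
  by rewrite card_family foldrE big_map big_enum.
rewrite natr_prod -[k in leRHS]card_ord -prodr_const.
by apply: ler_prod => j _; rewrite ler0n card_ord_interval.
Qed.

(** Volume comparison by counting. Compactness leaves finitely many cubes; on a grid of [L ^ k]
    points with every [r i * L] at least 1, cube [i] contains at most [(2 * r i * L + 1) ^ k <= (3 *
    r i * L) ^ k] of them. *)
Lemma cube_cover_sum (k : nat) (c : nat -> 'rV[R]_k) (r : nat -> R) :
  (forall i, 0 < r i) ->
  (forall a : 'rV[R]_k, (forall j, 0 <= a 0 j <= 1) ->
    exists i, forall j, `|c i 0 j - a 0 j| < r i) ->
  exists N, 1 <= \sum_(i < N) (3 * r i) ^+ k.
Proof.
move=> r0 cov.
have : compact [set a : 'rV[R]_k | forall j, `[0, 1]%classic (a ord0 j)].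
  exact (@rV_compact R k (fun=> `[0%R, 1%R]%classic) (fun=> @segment_compact R 0 1)).
rewrite compact_cover => /(_ nat setT (fun i => ball (c i) (r i))).
case=> [i _|x cx|D _ covD]; first exact: ball_open.
  have [|i ci] := cov x; first by move=> j; have := cx j; rewrite /= in_itv.
  by exists i => //; split=> // i0 j; rewrite ord1; exact: ci.
pose N := (\max_(i <- finmap.enum_fset D) i).+1; exists N.
pose L := (\max_(i < N) (Num.truncn (r i)^-1)).+1.
have rL i : (i < N)%N -> 1 <= r i * L%:R.
  move=> iN; rewrite mulrC -ler_pdivrMr// mul1r.
  apply/ltW; apply: lt_le_trans (truncnS_gt _) _.
  by rewrite ler_nat ltnS (leq_bigmax (Ordinal iN)).
have L0 : 0 < L%:R :> R by rewrite ltr0n.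
pose A i := [pred g : {ffun 'I_k -> 'I_L} |
  [forall j, `|(g j)%:R - L%:R * c i 0 j| < r i * L%:R]].
have : (L ^ k <= \sum_(i < N) #|A i|)%N.
  rewrite -{1}(card_ord L) -{1}(card_ord k) -card_ffun -sum1_card.
  apply: (@leq_trans (\sum_(g : {ffun 'I_k -> 'I_L}) \sum_(i < N) (g \in A i))).
    apply: leq_sum => g _.
    pose a : 'rV[R]_k := \row_j ((g j)%:R / L%:R).
    have /covD[i iD /= ai] :
        [set a : 'rV[R]_k | forall j, `[0%R, 1%R]%classic (a ord0 j)] a.
      move=> j; rewrite /= in_itv/= mxE divr_ge0//= ler_pdivrMr// mul1r.
      by rewrite ler_nat ltnW.
    have iN : (i < N)%N by rewrite ltnS; apply: leq_bigmax_seq.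
    rewrite (bigD1 (Ordinal iN))//= (_ : g \in A i) ?leq_addr//.
    rewrite inE; apply/forallP => j /=.
    have := ai.2 0 j.
    rewrite /ball/= mxE => h.
    rewrite distrC -[X in _ - X](divfK (negbT (gt_eqF L0))) (mulrC L%:R) -mulrBl normrM.
    by rewrite (gtr0_norm L0) ltr_pM2r.
  rewrite exchange_big/=; apply: leq_sum => i _.
  by rewrite -sum1_card [leqRHS]big_mkcond; apply: leq_sum => g _; case: ifP.
rewrite -(ler_nat R) natrX natr_sum => le.
have Lk0 : 0 < L%:R ^+ k :> R by rewrite exprn_gt0.
rewrite -(ler_pM2r Lk0) mul1r (le_trans le)// mulr_suml; apply: ler_sum => i _.
have h := rL _ (ltn_ord i).
apply: (le_trans (card_ffun_cube _ _ _)); first by rewrite (le_trans ler01).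
rewrite -exprMn lerXn2r ?nnegrE; lra.
Qed.

End CubeCover.

(** The parametrization has a Lipschitz inverse, so a cover of [S] pulls back to a cover of the unit
    cube by sup-norm balls. The sum of the [k]-th powers of the radii is then bounded below, hence
    so is that of the [s]-th powers, as [s <= k] and the sizes [e i] are at most 1. *)
Lemma affine_image_content_neq0 (R : realType) (n k : nat) (A : 'M[R]_(k, n))
    (o : 'rV[R]_n) (s : R) (S : set 'rV[R]_n) :
  row_free A -> (forall a : 'rV[R]_k, S (a *m A + o)) -> 0 < s <= k%:R ->
  hausdorff_content euclidean_dist s 1 S <> 0%E.
Proof.
move=> freeA fS /andP[s0 sk] S0; pose f (a : 'rV[R]_k) := a *m A + o.
have [C C0 fC] : exists2 C : R, 0 < C &
    forall (a b : 'rV[R]_k) j, `|a 0 j - b 0 j| <= C * enorm (f a - f b).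
  have [B AB] := row_freeP freeA.
  pose C := 1 + \sum_j \sum_i `|B i j|.
  have C0 : 0 < C by rewrite ltr_wpDr// !sumr_ge0// => j _; exact: sumr_ge0.
  exists C => // a b j.
  have -> : a 0 j - b 0 j = ((f a - f b) *m B) 0 j.
    by rewrite /f opprD addrACA subrr addr0 -mulmxBl -mulmxA AB mulmx1 !mxE.
  rewrite mxE (le_trans (ler_norm_sum _ _ _))// mulrC.
  apply: (@le_trans _ _ (\sum_i enorm (f a - f b) * `|B i j|)).
    by apply: ler_sum => i _; rewrite normrM ler_wpM2r// coord_le_enorm.
  rewrite -mulr_sumr ler_wpM2l ?enorm_ge0// /C (bigD1 j)//= addrCA lerDl.
  by rewrite addr_ge0// sumr_ge0// => l _; exact: sumr_ge0.
pose K := (3 * C) ^+ k.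
have K0 : 0 < K by rewrite exprn_gt0// mulr_gt0.
(* With this value [2 * eps <= 1] and [K * (2 * eps) < 1]: the first forces [e i <= 1], the second
   contradicts the lower bound on the sum. *)
pose eps := (4 * (K + 1))^-1.
have eps0 : 0 < eps by rewrite invr_gt0 mulr_gt0// addr_gt0.
have epsK : 4 * eps * K + 4 * eps = 1.
  by rewrite /eps; field; rewrite gt_eqF// addr_gt0.
have [U' [U [SU dU] <-] Ueps] :
    exists2 y, [set (\sum_(i <oo) poweR (diameter euclidean_dist (U i)) s)%E | U in
    [set U : nat -> set 'rV[R]_n | S `<=` \bigcup_i U i /\
       forall i, (diameter euclidean_dist (U i) <= 1%:E)%E]] y & (y < eps%:E)%E.
  by apply: ereal_inf_lt; move: S0; rewrite /hausdorff_content => ->; rewrite lte_fin.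
pose tau i := fine (poweR (diameter euclidean_dist (U i)) s).
have tauE i : poweR (diameter euclidean_dist (U i)) s = (tau i)%:E.
  rewrite fineK// ge0_fin_numE ?poweR_ge0// poweR_lty//.
  by rewrite (le_lt_trans (dU i))// ltry.
have tau0 i : 0 <= tau i by rewrite -lee_fin -tauE poweR_ge0.
pose h i := eps / (2 ^ i.+1)%:R.
have h0 i : 0 < h i by rewrite divr_gt0// ltr0n expn_gt0.
(* The summable increment [h i] makes every size positive and strictly larger than the diameter,
   even for sets of diameter 0. *)
pose e i := (tau i + h i) `^ s^-1.
have e0 i : 0 < e i by rewrite powR_gt0// ltr_wpDl.
have es i : e i `^ s = tau i + h i.
  by rewrite -powRrM mulVf ?gt_eqF// powRr1// addr_ge0// ltW.
have Ue i x y : U i x -> U i y -> enorm (x - y) < e i.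
  move=> Ux Uy; rewrite ltNge; apply/negP => exy.
  have : e i `^ s <= tau i.
    apply: (@le_trans _ _ (enorm (x - y) `^ s)).
      by rewrite ge0_ler_powR ?nnegrE ?enorm_ge0// ltW.
    rewrite -lee_fin -tauE -poweR_EFin gt0_ler_poweR ?(ltW s0)//.
    - by rewrite in_itv/= leey lee_fin enorm_ge0.
    - rewrite in_itv/= leey andbT; apply: le_trans (le_diameter Ux Uy).
      by rewrite lee_fin enorm_ge0.
    - exact: (@le_diameter _ _ euclidean_dist _ _ _ Ux Uy).
  by rewrite es; have := h0 i; lra.
have sum_e N : \sum_(i < N) e i `^ s <= 2 * eps.
  under eq_bigr do rewrite es.
  rewrite big_split/= mulr_natl mulr2n lerD// -lee_fin -sumEFin.
    apply: le_trans (ltW Ueps).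
    rewrite (eq_bigr (fun i : 'I_N => poweR (diameter euclidean_dist (U i)) s)) =>
      [|i _ //].
    rewrite -(big_mkord xpredT (fun i => poweR (diameter euclidean_dist (U i)) s)).
    by apply: nneseries_lim_ge => i _ _; exact: poweR_ge0.
  apply: le_trans (epsilon_trick0 xpredT (ltW eps0)).
  rewrite -(big_mkord xpredT (fun i => (h i)%:E)).
  by apply: nneseries_lim_ge => i _ _; rewrite lee_fin ltW.
(* A parameter whose image lies in [U i]; the default 0 occurs only for sets that miss the image. *)
pose c i := xget 0 [set a | U i (f a)].
have [a _|N] := @cube_cover_sum R k c (fun i => C * e i) (fun i => mulr_gt0 C0 (e0 i)).
  have [i _ Ui] := SU _ (fS a); exists i => j.
  have Uc : U i (f (c i)) by rewrite /c; case: xgetP => [_ _ //|/(_ a)].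
  by rewrite (le_lt_trans (fC _ _ _))// ltr_pM2l// Ue.
apply/negP; rewrite -ltNge.
apply: (@le_lt_trans _ _ (K * \sum_(i < N) e i `^ s)); last first.
  have := ler_wpM2l (ltW K0) (sum_e N); have := mulr_gt0 eps0 K0; nra.
rewrite mulr_sumr; apply: ler_sum => i _.
rewrite mulrA exprMn ler_wpM2l ?(ltW K0)// -powR_mulrn ?(ltW (e0 _))// ger_powR//.
rewrite e0/= leNgt; apply/negP => e1.
have : 1 < e i `^ s.
  have <- : 1 `^ s = 1 :> R by rewrite powR1.
  by rewrite gt0_ltr_powR// ?nnegrE ?ltW.
rewrite ltNge => /negP; apply; apply: (le_trans _ (le_trans (sum_e N) _)).
  by rewrite (bigD1 i)//= lerDl sumr_ge0// => j _; exact: powR_ge0.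
have := mulr_gt0 eps0 K0; nra.
Qed.

Lemma plane_points_content_neq0 (R : realType) (n k : nat) (P : affine_plane R n k)
    (s : R) : 0 < s <= k%:R ->
  hausdorff_content euclidean_dist s 1 (plane_points P) <> 0%E.
Proof.
case: P => V o dV oV; subst k.
pose A : 'M[R]_(\dim V, n) := \matrix_i (vbasis V)`_i.
have AV (a : 'rV_(\dim V)) : a *m A = \sum_i a 0 i *: (vbasis V)`_i.
  by rewrite mulmx_sum_row; apply: eq_bigr => i _; rewrite rowK.
apply: (@affine_image_content_neq0 _ _ _ A o).
  apply/row_freeP; have /eqP : kermx A = 0.
    apply/row_matrixP => i; rewrite row0; set u := row i _.
    have : u *m A = 0 by rewrite -row_mul mulmx_ker row0.
    rewrite AV => u0; apply/rowP => j; rewrite [RHS]mxE.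
    by have /freeP/(_ (fun i => u 0 i) u0 j) := basis_free (vbasisP V).
  by rewrite kermx_eq0 => /row_freeP.
move=> a; exists (a *m A) => //=; rewrite AV rpred_sum// => i _.
by rewrite rpredZ// vbasis_mem// mem_nth// size_tuple.
Qed.

(** * Packing dimension and separated sets *)

Section Packing.
Context {R : realType} {T : Type} (d : T -> T -> R).
Implicit Types (A : set T) (s delta : R).

(* The base point only serves to produce the empty packing: on an empty type the
   packing contents are [-oo]. *)
Lemma packing_premeasure_ge0 (x0 : T) s A : (0 <= packing_premeasure d s A)%E.
Proof.
apply: le_ereal_inf_tmp => _ [delta _ <-].
apply: ereal_sup_ubound; exists set0, (fun=> x0), (fun=> 0).
by rewrite esum_set0; split=> //; split=> // i j [].
Qed.

(* Finite families of points are indexed by [seq nat] because [T] need not have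
   decidable equality. *)
Definition separated_bound (t : R) A :=
  exists C r0 : R, [/\ 0 < C, 0 < r0 &
    forall r, 0 < r <= r0 -> forall (c : nat -> T) (F : seq nat), uniq F ->
      (forall i, i \in F -> A (c i)) ->
      (forall i j, i \in F -> j \in F -> i != j -> r < d (c i) (c j)) ->
      (size F)%:R <= C * r `^ (- t)].

(* Sorting the balls by dyadic radius, the level [delta 2^-(l+1) < r i <= delta 2^-l]
   has at most [C (delta 2^-(l+1))^-t] members, so the levels sum up to a
   geometric series of ratio [q = 2^-(s - t)]. *)
Lemma packing_sum_le (t s C r0 delta : R) (D : set nat) (c : nat -> T)
    (r : nat -> R) A (F : seq nat) :
  (forall x, d x x <= 0) -> t < s -> 0 < s -> 0 < C -> 0 < delta <= r0 ->
  (forall r, 0 < r <= r0 -> forall (c : nat -> T) (F : seq nat), uniq F ->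
      (forall i, i \in F -> A (c i)) ->
      (forall i j, i \in F -> j \in F -> i != j -> r < d (c i) (c j)) ->
      (size F)%:R <= C * r `^ (- t)) ->
  is_packing d delta A D c r -> uniq F -> (forall i, i \in F -> D i) ->
  \sum_(i <- F) (2 * r i) `^ s <=
    C * 4 `^ s * (delta / 2) `^ (s - t) / (1 - 2 `^ (- (s - t))).
Proof.
move=> dxx ts s0 C0 /andP[delta0 deltar] bnd [DP tD] Funiq FD.
set q := 2 `^ (- (s - t)).
have q1 : q < 1.
  rewrite /q powRN invf_lt1 ?powR_gt0//.
  have {1}<- : 1 `^ (s - t) = 1 :> R by rewrite powR1.
  by rewrite gt0_ltr_powR ?nnegrE ?subr_gt0// ltr1n.
have q0 : 0 < q by rewrite powR_gt0.
set B := _ / (1 - q).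
have B0 : 0 <= B.
  by rewrite /B divr_ge0 ?subr_ge0 ?(ltW q1)// !mulr_ge0 ?powR_ge0// ltW.
(* The center [c j] lies in its own ball, so by disjointness it is outside the ball around [c i]. *)
have far i j : i \in F -> j \in F -> i != j -> r i < d (c i) (c j).
  move=> iF jF ij; rewrite ltNge; apply/negP => dij.
  have [_ rj _] := DP _ (FD _ jF).
  move/eqP : ij; apply; apply: tD; [exact: FD|exact: FD|].
  by exists (c j); split=> //=; rewrite /cball/= (le_trans (dxx _))// ltW.
pose rad l : R := delta / 2 ^+ l.
have rad0 l : 0 < rad l by rewrite divr_gt0// exprn_gt0.
have level l : \sum_(i <- F | rad l.+1 < r i <= rad l) (2 * r i) `^ s
    <= B * (1 - q) * q ^+ l.
  apply: (@le_trans _ _ (\sum_(i <- F | rad l.+1 < r i <= rad l) (2 * rad l) `^ s)).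
    rewrite big_seq_cond [leRHS]big_seq_cond.
    apply: ler_sum => i /andP[/FD/DP[_ ri _] /andP[_ rl]].
    apply: ge0_ler_powR; rewrite ?nnegrE ?(ltW s0)//; have := rad0 l; lra.
  rewrite -big_filter big_const_seq count_predT iter_addr_0 -[leLHS]mulr_natl.
  set G := [seq _ <- _ | _].
  have Gs : (size G)%:R <= C * (rad l.+1) `^ (- t).
    apply: (bnd _ _ c); first 1 last.
    - by rewrite filter_uniq.
    - by move=> i; rewrite mem_filter => /andP[_ /FD/DP[]].
    - move=> i j; rewrite !mem_filter => /andP[/andP[ri _] iF] /andP[_ jF] ij.
      by rewrite (lt_trans ri)// far.
    rewrite rad0/= (le_trans _ deltar)// /rad ler_pdivrMr ?exprn_gt0//.
    by rewrite ler_peMr ?(ltW delta0)// exprn_ege1// ler1n.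
  apply: (le_trans (ler_wpM2r (powR_ge0 _ _) Gs)).
  rewrite /B divfK ?gt_eqF ?subr_gt0//.
  have -> : 2 * rad l = 4 * rad l.+1.
    by rewrite /rad exprS; field; rewrite expf_neq0.
  rewrite powRM ?(ltW (rad0 _))// -!mulrA ler_wpM2l ?(ltW C0)//.
  rewrite mulrCA ler_wpM2l ?powR_ge0//.
  rewrite -powRD; last by rewrite (gt_eqF (rad0 _)) implybT.
  have -> : q ^+ l = (2 ^- l) `^ (s - t).
    rewrite /q -powR_mulrn ?powR_ge0// powRAC powRN.
    by rewrite -powR_inv1 ?powR_ge0// powRAC powR_inv1 ?powR_ge0 ?powR_mulrn.
  rewrite -powRM ?invr_ge0 ?exprn_ge0 ?divr_ge0 ?(ltW delta0)//.
  rewrite (addrC (- t)) le_eqVlt; apply/orP; left; apply/eqP; congr (_ `^ _).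
  by rewrite /rad exprS invfM mulrA.
have partial l : \sum_(i <- F | rad l < r i) (2 * r i) `^ s <= B * (1 - q ^+ l).
  elim: l => [|l IH].
    rewrite expr0 subrr mulr0 big_seq_cond big1// => i /andP[/FD/DP[_ _ ri]].
    by rewrite /rad expr0 divr1 ltNge ri.
  rewrite (bigID (fun i => rad l < r i))/=.
  have -> : B * (1 - q ^+ l.+1) = B * (1 - q ^+ l) + B * (1 - q) * q ^+ l.
    by rewrite exprS; ring.
  apply: lerD.
    rewrite (eq_bigl (fun i => rad l < r i))// => i.
    apply/andP/idP => [[]//|h]; split=> //; apply: lt_trans h.
    rewrite /rad ltr_pM2l// ltf_pV2 ?posrE ?exprn_gt0//.
    by rewrite ltr_eXn2l ?ltr1n.
  rewrite (eq_bigl (fun i => rad l.+1 < r i <= rad l))// => i.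
  by rewrite -leNgt.
pose m := (\max_(i <- F) Num.truncn (delta / r i)).+1.
have Fm i : i \in F -> rad m < r i.
  move=> iF; have [_ ri _] := DP _ (FD _ iF).
  rewrite /rad ltr_pdivrMr ?exprn_gt0// mulrC -ltr_pdivrMr//.
  apply: lt_le_trans (truncnS_gt _) _.
  apply: (@le_trans _ _ m%:R).
    rewrite ler_nat ltnS.
    exact: (@leq_bigmax_seq _ F xpredT (fun i => Num.truncn (delta / r i))).
  by rewrite -natrX ler_nat ltnW// ltn_expl.
rewrite big_seq -(eq_bigl _ _ (fun i => andb_idr (Fm i))) -big_seq_cond.
apply: (le_trans (partial m)); rewrite ler_piMr// gerBl exprn_ge0// ltW//.
Qed.

Lemma separated_bound_premeasure0 (x0 : T) (t s : R) A :
  (forall x, d x x <= 0) -> t < s -> 0 < s -> separated_bound t A ->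
  packing_premeasure d s A = 0%E.
Proof.
move=> dxx ts s0 [C [r0 [C0 r00 bnd]]]; apply/eqP.
rewrite eq_le packing_premeasure_ge0// andbT.
apply/lee_addgt0Pr => e e0; rewrite add0e.
have st0 : 0 < s - t by rewrite subr_gt0.
have q1 : 0 < 1 - 2 `^ (- (s - t)) :> R.
  rewrite subr_gt0 powRN invf_lt1 ?powR_gt0//.
  have {1}<- : 1 `^ (s - t) = 1 :> R by rewrite powR1.
  by rewrite gt0_ltr_powR ?nnegrE ?subr_gt0// ltr1n.
pose K := C * 4 `^ s / (1 - 2 `^ (- (s - t))).
have K0 : 0 < K by rewrite divr_gt0// mulr_gt0// powR_gt0.
pose delta := Num.min r0 (2 * (e / K) `^ (s - t)^-1).
have delta0 : 0 < delta by rewrite lt_min r00/= mulr_gt0// powR_gt0// divr_gt0.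
have deltae : K * (delta / 2) `^ (s - t) <= e.
  rewrite mulrC -ler_pdivlMr//.
  have -> : e / K = ((e / K) `^ (s - t)^-1) `^ (s - t).
    by rewrite -powRrM mulVf ?gt_eqF// powRr1// ltW// divr_gt0.
  apply: ge0_ler_powR; rewrite ?nnegrE ?powR_ge0 ?divr_ge0 ?(ltW st0) ?(ltW delta0)//.
  by rewrite ler_pdivrMr// mulrC /delta ge_min lexx orbT.
apply: (@le_trans _ _ (packing_content d s delta A)).
  by apply: ereal_inf_lbound; exists delta.
apply: ge_ereal_sup => _ [D [c [r [pk ->]]]].
apply: ge_ereal_sup => _ [X [finX XD] <-].
rewrite fsbig_finite//= sumEFin lee_fin (le_trans _ deltae)//.
have delta_r : 0 < delta <= r0 by rewrite delta0/= /delta ge_min lexx.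
have := @packing_sum_le t s C r0 delta D c r A _ dxx ts s0 C0 delta_r bnd pk.
move=> /(_ _ (finmap.fset_uniq (fset_set X))) le.
apply: (le_trans (le _)) => [i|]; first by rewrite in_fset_set// inE => /XD.
by rewrite le_eqVlt; apply/orP; left; apply/eqP; rewrite /K; ring.
Qed.

Lemma packing_dim_le_separated (x0 : T) (t s : R) A (B : nat -> set T) :
  (forall x, d x x <= 0) -> t < s -> 0 < s -> A `<=` \bigcup_i B i ->
  (forall i, separated_bound t (B i)) -> (packing_dim d A <= s%:E)%E.
Proof.
move=> dxx ts s0 AB bnd; apply: ereal_inf_lbound; exists s => //; split=> //.
apply/eqP; rewrite eq_le; apply/andP; split.
  apply: ereal_inf_lbound; exists B => //.
  by apply: eseries0 => i _ _; exact: separated_bound_premeasure0 (bnd i).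
apply: le_ereal_inf_tmp => _ [E _ <-]; apply: nneseries_ge0 => i _ _.
exact: packing_premeasure_ge0.
Qed.

End Packing.

(** * Nets from small packing measure *)

Section EuclideanPacking.
Context {R : realType} {n : nat}.
Implicit Types (A E : set 'rV[R]_n) (s eps : R).

(** An [eps]-separated set in [E] is the set of centers of a packing by balls of radius [eps / 2],
    so the bound on packing sums limits its size to [eps^-s]. A separated set of maximal size is an
    [eps]-net. *)
Lemma packing_premeasure_has_nets s E : 0 < s ->
  (packing_premeasure euclidean_dist s E < 1%:E)%E -> has_nets s E.
Proof.
move=> s0 /ereal_inf_lt[_ [delta /= delta0 <-] E1].
exists 1, (2 * delta); split=> //; first by rewrite mulr_gt0.
move=> eps /andP[eps0 epsd].
pose sep (X : seq 'rV[R]_n) :=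
  (forall x, x \in X -> E x) /\ pairwise (fun x y => eps < enorm (x - y)) X.
have sep_size X : sep X -> (size X)%:R <= 1 * eps `^ (- s).
  move=> [XE Xp]; rewrite mul1r powRN -[leRHS]mul1r ler_pdivlMr ?powR_gt0//.
  rewrite -lee_fin; apply: le_trans (ltW E1); apply: ereal_sup_ubound.
  exists `I_(size X), (nth 0 X), (fun=> eps / 2); split; last first.
    rewrite esum_fset// => [|i _]; last by rewrite lee_fin powR_ge0.
    rewrite -fsbig_ord sumEFin sumr_const card_ord [in LHS]mulr_natl.
    by rewrite [2 * _]mulrC divfK.
  split=> [i iX|].
    split; [by apply: XE; rewrite mem_nth|by rewrite divr_gt0|].
    by rewrite ler_pdivrMr// mulrC.
  apply/trivIsetP => i j iX jX ij; apply/seteqP; split=> // y [/= iy jy].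
  wlog ltij : i j iX jX ij iy jy / (i < j)%N.
    move=> h; case: (ltngtP i j) => [|/h|eij]; [exact: h|apply=> //|].
      by rewrite eq_sym.
    by rewrite eij eqxx in ij.
  have /(pairwiseP 0)/(_ _ _ iX jX ltij) := Xp.
  rewrite ltNge => /negP; apply; rewrite (le_trans (ler_enorm_dist y _ _))//.
  rewrite [leRHS]splitr lerD//.
  by rewrite enormBC; exact: jy.
have ex : exists N, `[< exists2 X, sep X & size X = N >].
  by exists 0%N; apply/asboolP; exists [::].
have bd N : `[< exists2 X, sep X & size X = N >] ->
    (N <= Num.truncn (1 * eps `^ (- s)))%N.
  move=> /asboolP[X /sep_size le <-].
  by rewrite -(natrK (R := R) (size X)) le_truncn.
case: (ex_maxnP ex bd) => N /asboolP[X sX XN] Nmax.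
exists X; split; first exact: sep_size.
move=> y Ey; apply: contrapT => noz.
have /Nmax : `[< exists2 X, sep X & size X = N.+1 >].
  apply/asboolP; exists (y :: X); last by rewrite /= XN.
  split=> [x|]; first by rewrite inE => /predU1P[->//|]; exact: sX.1.
  rewrite pairwise_cons sX.2 andbT; apply/allP => z zX.
  by rewrite ltNge; apply/negP => le; apply: noz; exists z.
by rewrite ltnn.
Qed.

(** In a cover of total premeasure below 1, each member has premeasure below 1. *)
Lemma packing_measure0_nets s A : 0 < s -> packing_measure euclidean_dist s A = 0%E ->
  exists2 E : nat -> set 'rV[R]_n, A `<=` \bigcup_i E i & forall i, has_nets s (E i).
Proof.
move=> s0 A0; have : (packing_measure euclidean_dist s A < 1%:E)%E.
  by rewrite A0 lte_fin.
move=> /ereal_inf_lt[_ [E AE <-] sumE]; exists E => // i.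
apply: packing_premeasure_has_nets => //; apply: le_lt_trans sumE.
have ge0 j : (0 <= packing_premeasure euclidean_dist s (E j))%E.
  exact: packing_premeasure_ge0 0 _ _.
apply: (le_trans _ (nneseries_lim_ge i.+1 _)) => [|j _ _]; last exact: ge0.
by rewrite big_nat_recr//= leeDr// sume_ge0.
Qed.

End EuclideanPacking.

(** * Pigeonhole selection of frames *)

Section FramesInSubspaces.
Context {R : realType} {n : nat}.
Implicit Types (u v x y : 'rV[R]_n) (V : {vspace 'rV[R]_n}) (e f : nat -> 'rV[R]_n).

Lemma orthonormal_span e j : orthonormal e j ->
  free [tuple e p | p < j] /\
  forall v, v \in <<[tuple e p | p < j]>>%VS -> v = frame_proj e j v.
Proof.
move=> ej; set X := [tuple e p | p < j].
have XE (p : 'I_j) : X`_p = e p by rewrite -tnth_nth tnth_mktuple.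
split=> [|v vX].
  apply/freeP => a a0 p; have : dotp (\sum_(i < j) a i *: X`_i) (e p) = 0.
    by rewrite a0 dotp0l.
  rewrite dotp_suml (bigD1 p)//= dotpZl XE ej// eqxx mulr1 big1 ?addr0// => q qp.
  by rewrite dotpZl XE ej// (_ : (q == p :> nat) = false) ?mulr0//; exact: negbTE.
apply/eqP; rewrite -subr_eq0; apply/eqP/dotpp_eq0; set w := v - _.
have wX : w \in <<X>>%VS.
  rewrite rpredB// rpred_sum// => p _; rewrite rpredZ// memv_span//.
  by rewrite -XE mem_nth// size_tuple.
rewrite {1}(coord_span wX) dotp_suml big1// => p _.
by rewrite dotpZl XE dotpC frame_proj_ortho ?mulr0.
Qed.

Lemma orthonormal_dim V e j : orthonormal e j ->
  (forall p, (p < j)%N -> e p \in V) -> (j <= \dim V)%N.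
Proof.
move=> ej eV; have [/eqnP/= freeX _] := orthonormal_span ej.
rewrite size_tuple card_ord in freeX; rewrite -freeX dimvS//.
by apply/span_subvP => _ /mapP[p _ ->]; rewrite eV.
Qed.

Lemma orthoproj_frame V e j x : orthonormal e j ->
  (forall p, (p < j)%N -> e p \in V) -> \dim V = j ->
  orthoproj V x = frame_proj e j x.
Proof.
move=> ej eV dV; have [/eqnP/= freeX spanX] := orthonormal_span ej.
rewrite size_tuple card_ord in freeX; have [pV pO] := orthoprojP V x.
have VE : <<[tuple e p | p < j]>>%VS = V.
  apply/eqP; rewrite eqEdim freeX dV leqnn andbT.
  by apply/span_subvP => _ /mapP[p _ ->]; rewrite eV.
apply: orthoproj_unique pV pO _ _.
  by rewrite rpred_sum// => p _; rewrite rpredZ// eV.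
move=> v vV; rewrite (spanX v) ?VE// dotpC dotp_suml big1// => p _.
by rewrite dotpZl (dotpC (e p)) frame_proj_ortho ?mulr0.
Qed.

(** Each of the [j] summands changes in three ways: through the projected vector, through the frame
    vector inside the product, and through the frame vector outside it. *)
Lemma frame_proj_close e f j (delta : R) u v : orthonormal e j -> orthonormal f j ->
  (forall p, (p < j)%N -> enorm (e p - f p) <= delta) ->
  enorm (frame_proj e j u - frame_proj f j v) <=
    j%:R * (enorm (u - v) + 2 * enorm v * delta).
Proof.
move=> ej fj ef; rewrite /frame_proj -sumrB (le_trans (ler_enorm_sum _ _ _))//.
rewrite -[j in leRHS]card_ord mulr_natl -sumr_const; apply: ler_sum => p _.
have -> : dotp u (e p) *: e p - dotp v (f p) *: f p =
    dotp (u - v) (e p) *: e p + (dotp v (e p - f p) *: e p +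
    dotp v (f p) *: (e p - f p)).
  rewrite dotpBl (dotpC v (_ - _)) dotpBl ![dotp _ v]dotpC scalerBr !scalerBl.
  by rewrite [X in _ = _ + X]addrA subrK addrA subrK.
have d0 : 0 <= delta by exact: le_trans (enorm_ge0 _) (ef p (ltn_ord p)).
have e1 := orthonormal_enorm ej (ltn_ord p).
have f1 := orthonormal_enorm fj (ltn_ord p).
have v0 := enorm_ge0 v.
apply: (le_trans (ler_enormD _ _)); apply: lerD.
  by rewrite enormZ e1 mulr1 (le_trans (dotp_le _ _))// e1 mulr1.
apply: (le_trans (ler_enormD _ _)); rewrite -mulrA mulrDl mul1r lerD//.
  rewrite enormZ e1 mulr1 (le_trans (dotp_le _ _))// ler_wpM2l//.
  exact: ef.
rewrite enormZ ler_pM ?enorm_ge0 ?ef//.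
by rewrite (le_trans (dotp_le _ _))// f1 mulr1.
Qed.

(** Away from the origin normalization is Lipschitz. This is why new points are picked at distance
    more than a fixed [eta] from the affine span of the earlier ones. *)
Lemma normalize_close u v (eta : R) : 0 < eta -> eta <= enorm u -> eta <= enorm v ->
  enorm ((enorm u)^-1 *: u - (enorm v)^-1 *: v) <= 2 / eta * enorm (u - v).
Proof.
move=> eta0 ue ve; have u0 := lt_le_trans eta0 ue; have v0 := lt_le_trans eta0 ve.
have -> : (enorm u)^-1 *: u - (enorm v)^-1 *: v =
    (enorm u)^-1 *: (u - v) + ((enorm u)^-1 - (enorm v)^-1) *: v.
  by rewrite scalerBr scalerBl addrA subrK.
have uV : (enorm u)^-1 <= eta^-1 by rewrite lef_pV2.
have norm1 : enorm ((enorm u)^-1 *: (u - v)) <= eta^-1 * enorm (u - v).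
  by rewrite enormZ ger0_norm ?invr_ge0 ?enorm_ge0// ler_wpM2r ?enorm_ge0.
have norm2 : enorm (((enorm u)^-1 - (enorm v)^-1) *: v) <= eta^-1 * enorm (u - v).
  rewrite enormZ -[X in _ * X](gtr0_norm v0) -normrM mulrBl (mulVf (negbT (gt_eqF v0))).
  rewrite -[X in _ - X](mulVf (negbT (gt_eqF u0))) -mulrBr normrM.
  rewrite ger0_norm ?invr_ge0 ?enorm_ge0// ler_pM ?invr_ge0 ?enorm_ge0//.
  by rewrite distrC ler_enorm_sub.
apply: (le_trans (ler_enormD _ _)); apply: (le_trans (lerD norm1 norm2)).
by rewrite -mulrDl -mulr2n mulr_natl.
Qed.

End FramesInSubspaces.

(** Double counting of the pairs [(i, x)] with [hit i x]. The default [x0] serves for empty [X],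
    where the left side is at most 0. *)
Lemma pigeonhole_seq (R : realType) (T : eqType) (F : seq nat) (X : seq T) (x0 : T)
    (hit : nat -> T -> bool) (N : R) :
  (forall i, i \in F -> N <= (count (hit i) X)%:R) ->
  exists x, (size F)%:R * N <= (size X)%:R * (size [seq i <- F | hit i x])%:R.
Proof.
move=> Nhit; have total : (size F)%:R * N <=
    \sum_(x <- X) (size [seq i <- F | hit i x])%:R.
  have -> : \sum_(x <- X) (size [seq i <- F | hit i x])%:R =
      \sum_(i <- F) (count (hit i) X)%:R :> R.
    rewrite -!natr_sum; congr (_%:R).
    under eq_bigr do rewrite size_filter -sum1_count big_mkcond.
    rewrite exchange_big/=; apply: eq_bigr => i _.
    by rewrite -sum1_count [RHS]big_mkcond.
  rewrite mulr_natl -sum1_size -sumrMnr big_seq [leRHS]big_seq.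
  by apply: ler_sum => i /Nhit; rewrite mulr1n.
case: X Nhit total => [|x1 X] Nhit total.
  by exists x0; move: total; rewrite big_nil mul0r.
apply: contrapT => no; set K := (size (x1 :: X))%:R : R in no *.
have lt x : K * (size [seq i <- F | hit i x])%:R < (size F)%:R * N.
  by rewrite ltNge; apply/negP => h; apply: no; exists x.
have : K * (size F)%:R * N < K * ((size F)%:R * N).
  rewrite -mulrA; apply: (@le_lt_trans _ _ (K * _)).
    by apply: ler_wpM2l total; rewrite ler0n.
  rewrite [ltRHS]mulrC {2}/K /= -natr1 mulrDr mulr1 addrC big_cons mulrDr.
  rewrite ltr_leD// mulr_sumr [leRHS]mulr_natr -(sum1_size X) -sumrMnr.
  by apply: ler_sum => x _; rewrite mulr1n ltW.
by rewrite mulrA ltxx.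
Qed.

(** * Picking nearby points in many planes *)

Section Slots.
Context {R : realType} {n k : nat}.
Implicit Types (Q : affine_plane R n k -> set 'rV[R]_n) (A : set (affine_plane R n k)).

Lemma content_le_balls (s : R) (S : set 'rV[R]_n) (p : seq ('rV[R]_n * R)) : 0 < s ->
  S `<=` [set x | exists2 q, q \in p & enorm (x - q.1) <= q.2] ->
  (forall q, q \in p -> 0 <= 2 * q.2 <= 1) ->
  (hausdorff_content euclidean_dist s 1 S <= (\sum_(q <- p) (2 * q.2) `^ s)%:E)%E.
Proof.
move=> s0 Sp p1.
pose g (q : 'rV[R]_n * R) : set 'rV[R]_n * R :=
  ([set x | enorm (x - q.1) <= q.2], 2 * q.2).
have := @content_le_finite_cover R _ euclidean_dist (fun x y => enorm_ge0 _) s 1 S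
  (map g p) s0.
rewrite big_map; apply.
  move=> x /Sp[q qp xq]; exists (index q p); first by rewrite size_map index_mem.
  by rewrite (nth_map q) ?index_mem// nth_index.
move=> i; rewrite size_map => ip; rewrite (nth_map (0, 0))//=.
have qp : nth (0, 0) p i \in p by rewrite mem_nth.
split; first exact: p1.
apply: diameter_le => x y /= xq yq.
rewrite /euclidean_dist (le_trans (ler_enorm_dist (nth (0, 0) p i).1 _ _))//.
by rewrite mulr_natl mulr2n lerD// enormBC.
Qed.

(** A source of points for the planes of [A]: [Q P] is the part of [P] from which a point may be
    picked. The set [E] and the lower bound [c0] are common to all planes of [A]. *)
Definition slot A Q (M a b c0 : R) :=
  exists2 E, has_nets a E & forall P, A P ->
    [/\ Q P `<=` E, Q P `<=` plane_points P, Q P `<=` [set x | enorm x <= M] &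
        (c0%:E <= hausdorff_content euclidean_dist b 1 (Q P))%E].

(** The bad part of each [Q (c i)] uses at most half of the content [c0], so the rest meets at least
    [N], of order [eps^-b], of the [O(eps^-a)] balls of the net. By pigeonhole one ball is met for a
    proportion of order [eps^(a - b)] of the planes, and points in one ball are [2 * eps]-close. *)
Lemma slot_pick A Q (M a b c0 : R) : 0 < b -> 0 < c0 -> slot A Q M a b c0 ->
  exists L e0 : R, [/\ 0 < L, 0 < e0 & forall eps, 0 < eps <= e0 ->
    forall (c : nat -> affine_plane R n k) (F : seq nat) (bad : nat -> set 'rV[R]_n),
    (forall i, i \in F -> A (c i)) ->
    (forall i, i \in F -> exists (X : seq 'rV[R]_n) (r : R),
      [/\ 0 <= r, 2 * r <= 1, (size X)%:R * (2 * r) `^ b <= c0 / 2 &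
       forall x, Q (c i) x -> bad i x -> exists2 z, z \in X & enorm (x - z) <= r]) ->
    exists (p : pred nat) (y : nat -> 'rV[R]_n),
      [/\ (size F)%:R * eps `^ (a - b) <= L * (size [seq i <- F | p i])%:R,
          forall i, i \in [seq i <- F | p i] -> Q (c i) (y i) /\ ~ bad i (y i) &
          forall i i', i \in [seq i <- F | p i] -> i' \in [seq i <- F | p i] ->
            enorm (y i - y i') <= 2 * eps]].
Proof.
move=> b0 c00 [E [C [e1 [C0 e10 net]]] AQ].
(* The bound [2^-1] on [eps] keeps the balls of the net admissible at scale 1. *)
exists (C * 2 `^ b * 2 / c0), (Num.min e1 2^-1); split.
- by rewrite divr_gt0// !mulr_gt0// powR_gt0.
- by rewrite lt_min e10/= invr_gt0 ltr0n.
move=> eps /andP[eps0]; rewrite le_min => /andP[epse1 eps2] c F bad FA Fbad.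
have eps21 : 2 * eps <= 1 by rewrite mulrC -ler_pdivlMr// mul1r.
have [X [Xs Xn]] : exists X : seq 'rV[R]_n, (size X)%:R <= C * eps `^ (- a) /\
      forall x, E x -> exists2 z, z \in X & enorm (x - z) <= eps.
  by apply: net; rewrite eps0.
pose good i z x := [/\ Q (c i) x, ~ bad i x & enorm (x - z) <= eps].
pose hit i z := `[< exists x, good i z x >].
pose N := c0 / 2 / (2 * eps) `^ b.
have Nhit i : i \in F -> N <= (count (hit i) X)%:R.
  move=> iF; have [QE QP QM Qc] := AQ _ (FA _ iF).
  have [Y [r [r0 r1 Yr Yn]]] := Fbad _ iF.
  rewrite ler_pdivrMr ?powR_gt0 ?mulr_gt0//.
  suff : c0 <= c0 / 2 + (count (hit i) X)%:R * (2 * eps) `^ b by lra.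
  rewrite -lee_fin; apply: (le_trans Qc).
  pose p := [seq (z, r) | z <- Y] ++ [seq (z, eps) | z <- X & hit i z].
  apply: (le_trans (@content_le_balls b _ p b0 _ _)).
  - move=> x Qx; have [bx|bx] := pselect (bad i x).
      have [z zY xz] := Yn _ Qx bx; exists (z, r) => //.
      by rewrite mem_cat map_f.
    have [z zX xz] := Xn _ (QE _ Qx); exists (z, eps) => //.
    rewrite mem_cat map_f ?orbT// mem_filter zX andbT.
    by apply/asboolP; exists x.
  - move=> q; rewrite mem_cat => /orP[] /mapP[z _ ->]/=.
      by rewrite r1 andbT mulr_ge0.
    by rewrite eps21 andbT mulr_ge0// ltW.
  rewrite lee_fin big_cat/= !big_map/= lerD//.
    by rewrite big_const_seq count_predT iter_addr_0 -[leLHS]mulr_natl.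
  by rewrite big_const_seq count_predT iter_addr_0 -[leLHS]mulr_natl size_filter.
have [z Fz] := pigeonhole_seq 0 Nhit.
pose y i := xget 0 [set x | good i z x].
have yP i : i \in [seq i <- F | hit i z] -> good i z (y i).
  rewrite mem_filter => /andP[/asboolP[x gx] _].
  by rewrite /y; case: xgetP => [w _ //|/(_ x)].
exists (hit^~ z), y; split.
- rewrite powRB; last by rewrite (gt_eqF eps0) implybT.
  set G := (size [seq _ <- _ | _])%:R in Fz *.
  have e_a := powR_gt0 a eps0; have e_b := powR_gt0 b eps0.
  have {Fz} : (size F)%:R * N <= C * eps `^ (- a) * G.
    by apply: (le_trans Fz); rewrite ler_wpM2r// ler0n.
  rewrite /N powRM ?(ltW eps0)// powRN => h.
  have two_b : 0 < 2 `^ b :> R by rewrite powR_gt0.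
  have w0 : 0 <= eps `^ a * 2 `^ b * 2 / c0.
    by rewrite divr_ge0 ?mulr_ge0// ltW.

  have -> : (size F)%:R * (eps `^ a / eps `^ b) = eps `^ a * 2 `^ b * 2 / c0 *
      ((size F)%:R * (c0 / 2 / (2 `^ b * eps `^ b))).
    by field; rewrite !gt_eqF.
  have -> : C * 2 `^ b * 2 / c0 * G = eps `^ a * 2 `^ b * 2 / c0 *
      (C / eps `^ a * G) by field; rewrite !gt_eqF.
  exact: ler_wpM2l.
- by move=> i /yP[].
- move=> i i' /yP[_ _ h] /yP[_ _ h'].
  rewrite (le_trans (ler_enorm_dist z _ _))// mulr_natl mulr2n lerD//.
  by rewrite enormBC.
Qed.

End Slots.

(** * Growing nearly equal frames *)

Section FrameGrowth.
Context {R : realType} {n k : nat}.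
Implicit Types (Q : affine_plane R n k -> set 'rV[R]_n) (A : set (affine_plane R n k)).
Implicit Types (c : nat -> affine_plane R n k) (F : seq nat).
Implicit Types (y : nat -> 'rV[R]_n) (e : nat -> nat -> 'rV[R]_n).

(** The [j + 1] points in general position are recorded as a base point [y i] and an orthonormal
    frame [e i] of directions in the plane, so that closeness of planes can be read off from
    closeness of frames. *)
Definition frame_state c F (M : R) (j : nat) (delta : R) y e :=
  [/\ forall i, i \in F -> plane_points (c i) (y i) /\ enorm (y i) <= M,
      forall i, i \in F -> orthonormal (e i) j /\
        forall p, (p < j)%N -> e i p \in dir (c i) &
      forall i i', i \in F -> i' \in F -> enorm (y i - y i') <= delta /\
        forall p, (p < j)%N -> enorm (e i p - e i' p) <= delta].

(* A proportion [eps ^ x] of the planes can be kept so that frames of length [j]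
   that agree up to [K * eps] are replaced by frames of length [l] that agree up to
   [K' * eps]. *)
Definition advance A (M : R) (j : nat) (K : R) (l : nat) (K' x : R) :=
  exists L e0 : R, [/\ 0 < L, 0 < e0 & forall eps, 0 < eps <= e0 ->
    forall c F y e, uniq F -> (forall i, i \in F -> A (c i)) ->
    frame_state c F M j (K * eps) y e ->
    exists F' y' e', [/\ uniq F', {subset F' <= F},
      frame_state c F' M l (K' * eps) y' e' &
      (size F)%:R * eps `^ x <= L * (size F')%:R]].

Lemma advance_trans A M j K l K' m K'' x x' :
  advance A M j K l K' x -> advance A M l K' m K'' x' ->
  advance A M j K m K'' (x + x').
Proof.
move=> [L [e0 [L0 e00 adv]]] [L' [e0' [L0' e00' adv']]].
exists (L' * L), (Num.min e0 e0'); split; [exact: mulr_gt0|by rewrite lt_min e00|].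
move=> eps /andP[eps0]; rewrite le_min => /andP[epse epse'] c F y e Funiq FA st.
have [|F1 [y1 [e1 [F1u F1F st1 F1s]]]] := adv eps _ c F y e Funiq FA st.
  by rewrite eps0.
have [||F2 [y2 [e2 [F2u F2F st2 F2s]]]] := adv' eps _ c F1 y1 e1 F1u _ st1.
- by rewrite eps0.
- by move=> i /F1F/FA.
exists F2, y2, e2; split=> //; first by move=> i /F2F/F1F.
rewrite powRD; last by rewrite (gt_eqF eps0) implybT.
rewrite mulrA; apply: (le_trans (ler_wpM2r (powR_ge0 _ _) F1s)).
by rewrite [L' * L]mulrC -!mulrA ler_pM2l.
Qed.

Lemma advance_refl A M j K : advance A M j K j K 0.
Proof.
exists 1, 1; split=> // eps _ c F y e Fu _ st; exists F, y, e; split=> //.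
by rewrite powRr0 mulr1 mul1r.
Qed.

(** The first pick has nothing to avoid and gives the base points; the frames are still empty. *)
Lemma frame_init A Q M a b g : 0 < b -> 0 < g -> slot A Q M a b g ->
  exists L e0 : R, [/\ 0 < L, 0 < e0 & forall eps, 0 < eps <= e0 ->
    forall c F, uniq F -> (forall i, i \in F -> A (c i)) ->
    exists F' y e, [/\ uniq F', {subset F' <= F},
      frame_state c F' M 0 (2 * eps) y e &
      (size F)%:R * eps `^ (a - b) <= L * (size F')%:R]].
Proof.
move=> b0 g0 sl; have [L [e0 [L0 e00 pick]]] := slot_pick b0 g0 sl.
have [E _ AQ] := sl; exists L, e0; split=> // eps epse c F Fu FA.
have [i iF|p [y [ps yQ yy]]] := pick eps epse c F (fun=> set0) FA.
  exists [::], 0; split=> //; rewrite ?mulr0// mul0r divr_ge0// ltW//.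
exists [seq i <- F | p i], y, (fun=> fun=> 0); split=> //.
- by rewrite filter_uniq.
- by move=> i; rewrite mem_filter => /andP[].
split=> // [i iF|i i' iF iF'].
  have Ai : A (c i) by apply: FA; move: iF; rewrite mem_filter => /andP[].
  have [_ QP QM _] := AQ _ Ai.
  by have [Qy _] := yQ _ iF; split; [exact: QP|exact: QM].
by split=> //; exact: yy.
Qed.

Lemma plane_points_subr P (x y : 'rV[R]_n) : plane_points P x -> plane_points P y ->
  x - y \in @dir R n k P.
Proof.
by move=> [u /= uV <-] [v /= vV <-]; rewrite opprD addrACA subrr addr0 rpredB.
Qed.

(** One Gram-Schmidt step: a point of [Q] is picked outside the [eta]-neighbourhood of the affine
    span of the frame, and its normalized residual becomes the new vector. Since [eta] does not
    depend on [eps], agreement stays linear in [eps]. The hypothesis [j%:R < b] makes the avoided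
    neighbourhood small in content. *)
Lemma frame_step A Q M a b g j (K : R) : 0 <= M -> j%:R < b -> 0 < g -> 0 <= K ->
  slot A Q M a b g -> exists2 K', 0 <= K' & advance A M j K j.+1 K' (a - b).
Proof.
move=> M0 jb g0 K0 sl; have b0 : 0 < b by apply: le_lt_trans jb; rewrite ler0n.
have [L [e0 [L0 e00 pick]]] := slot_pick b0 g0 sl.
have g20 : 0 < g / 2 by rewrite divr_gt0.
have [eta eta0 cov] := @frame_nbhd_small_cover R n j b M (g / 2) M0 jb g20.
have [E _ AQ] := sl.
(* The factor [2 / eta] comes from normalization, [2 + K] from the differences [x i - y i], and the
   term with [j] from their projections, the differences having norm at most [2 * M]. *)
pose K1 := 2 / eta * (2 + K + j%:R * (2 + K + 4 * M * K)).
have K10 : 0 <= K1.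
  by rewrite mulr_ge0 ?divr_ge0 ?(ltW eta0)// !addr_ge0// mulr_ge0// !addr_ge0// !mulr_ge0.
exists (K + K1); first exact: addr_ge0.
exists L, e0; split=> // eps epse c F y e Fu FA [yF eF close].
have /andP[eps0 _] := epse.
pose res i x := x - y i - frame_proj (e i) j (x - y i).
have [i iF|p [x [ps xQ xx]]] :=
  pick eps epse c F (fun i => [set x | enorm (res i x) <= eta]) FA.
  have [X [r [r0 r1 Xr Xn]]] := cov (e i) (y i) (eF _ iF).1 (yF _ iF).2.
  exists X, r; split=> // z Qz bz; apply: Xn => //.
  by have [_ _ QM _] := AQ _ (FA _ iF); exact: QM.
pose w i := res i (x i).
pose e' i q := if q == j then (enorm (w i))^-1 *: w i else e i q.
set F' := [seq i <- F | p i] in ps xQ xx *.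
have FF i : i \in F' -> i \in F by rewrite mem_filter => /andP[].
have w_eta i : i \in F' -> eta < enorm (w i).
  by move=> /xQ[_ /negP]; rewrite -ltNge.
exists F', y, e'; split=> //; first by rewrite filter_uniq.
split=> [i /FF/yF//|i iF|i i' iF iF'].
- have [ei eV] := eF _ (FF _ iF).
  have we q : (q < j)%N -> dotp (w i) (e i q) = 0 by exact: frame_proj_ortho.
  have w0 := lt_trans eta0 (w_eta _ iF).
  have lt_of q : (q < j.+1)%N -> q != j -> (q < j)%N.
    by move=> qj ?; rewrite ltn_neqAle -ltnS qj andbT.
  split=> [q q' /lt_of + /lt_of|q /lt_of]; rewrite /e'.
    have [->|qj] := eqVneq q j; have [->|qj'] := eqVneq q' j.
    + move=> _ _; rewrite dotpZl dotpC dotpZl -sqr_enorm ?eqxx mulrA -invfM -expr2.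
      by rewrite mulVf// expf_neq0// gt_eqF.
    + move=> _ /(_ isT) qlt; rewrite dotpZl we// mulr0 ?gtn_eqF//.
    + move=> /(_ isT) qlt _; rewrite dotpC dotpZl we// mulr0 ?ltn_eqF//.
    + by move=> /(_ isT) qlt /(_ isT) qlt'; exact: ei.
  have [_ _|qj /(_ isT)] := eqVneq q j; last exact: eV.
  have [_ QP _ _] := AQ _ (FA _ (FF _ iF)).
  rewrite rpredZ// rpredB//; last first.
    by rewrite rpred_sum// => q' _; rewrite rpredZ// eV.
  apply: plane_points_subr; last exact: (yF _ (FF _ iF)).1.
  by apply: QP; exact: (xQ _ iF).1.
- have [yy ee] := close _ _ (FF _ iF) (FF _ iF').
  split=> [|q]; first by rewrite (le_trans yy)// mulrDl lerDl mulr_ge0// ltW.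
  rewrite ltnS leq_eqVlt /e'; have [_ _|qj /= qlt] := eqVneq q j; last first.
    by rewrite (le_trans (ee _ qlt))// mulrDl lerDl mulr_ge0// ltW.
  have [/eF[ei _] /eF[ei' _]] := (FF _ iF, FF _ iF').
  have uu : enorm ((x i - y i) - (x i' - y i')) <= (2 + K) * eps.
    rewrite opprB (addrC (y i')) addrACA (addrC (- y i)).
    rewrite (le_trans (ler_enormD _ _))// mulrDl lerD//; first exact: xx.
    by rewrite enormBC.
  have u'M : enorm (x i' - y i') <= 2 * M.
    rewrite (le_trans (ler_enormB _ _))// mulr_natl mulr2n lerD//.
      by have [_ _ QM _] := AQ _ (FA _ (FF _ iF')); apply: QM; exact: (xQ _ iF').1.
    exact: (yF _ (FF _ iF')).2.
  have ww : enorm (w i - w i') <= (2 + K + j%:R * (2 + K + 4 * M * K)) * eps.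
    rewrite /w /res; set u := x i - y i; set u' := x i' - y i' in u'M *.
    have -> : u - frame_proj (e i) j u - (u' - frame_proj (e i') j u') =
        (u - u') - (frame_proj (e i) j u - frame_proj (e i') j u').
      by rewrite !opprB addrACA [RHS]addrACA; congr (_ + _); rewrite addrC.
    rewrite (le_trans (ler_enormB _ _))// mulrDl lerD//.
    apply: (le_trans (frame_proj_close u u' ei ei' ee)).
    rewrite -[leRHS]mulrA ler_wpM2l//.
    rewrite [leRHS]mulrDl lerD//.
    have := ler_wpM2r (mulr_ge0 K0 (ltW eps0)) u'M; lra.
  apply: (le_trans (normalize_close eta0 (ltW (w_eta _ iF)) (ltW (w_eta _ iF')))).
  apply: (@le_trans _ _ (K1 * eps)).
    by rewrite /K1 -[leRHS]mulrA ler_wpM2l// divr_ge0// ltW.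
  by rewrite mulrDl lerDr mulr_ge0// ltW.
Qed.

(** The last step starts from length [j + l - 1], hence the [b + 1] in the hypothesis. *)
Lemma frame_steps A Q M a b g j l (K : R) : 0 <= M -> (j + l)%:R < b + 1 -> 0 < g ->
  0 <= K -> slot A Q M a b g ->
  exists2 K', 0 <= K' & advance A M j K (j + l) K' (l%:R * (a - b)).
Proof.
move=> M0 + g0 K0 sl; elim: l => [|l IH] jb.
  by exists K => //; rewrite addn0 mul0r; exact: advance_refl.
have [|K' K'0 adv] := IH.
  by apply: lt_trans jb; rewrite ltr_nat addnS.
have jlb : (j + l)%:R < b by move: jb; rewrite addnS -natr1 ltrD2r.
have [K2 K20 adv'] := frame_step M0 jlb g0 K'0 sl.
exists K2 => //; rewrite addnS -natr1 mulrDl mul1r.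
exact: advance_trans adv adv'.
Qed.

End FrameGrowth.

(** * Separated families of planes *)

Section PlaneFamilies.
Context {R : realType} {n k : nat}.
Implicit Types (P : affine_plane R n k) (Q : affine_plane R n k -> set 'rV[R]_n).
Implicit Types (A : set (affine_plane R n k)).

Lemma plane_dist_le P P' (B : R) : 0 <= B ->
  (forall x, enorm x = 1 -> enorm (orthoproj (dir P) x - orthoproj (dir P') x) <= B) ->
  plane_dist P P' <= B + enorm (offset P - offset P').
Proof.
move=> B0 PB; rewrite /plane_dist lerD2r; set S := (X in sup X).
(* The unit sphere is empty for [n = 0]; the supremum is then 0. *)
have [->|/set0P S0] := eqVneq S set0; first by rewrite sup0.
by apply: ge_sup => // _ [x /= x1 <-]; exact: PB.
Qed.

Lemma plane_dist_refl P : plane_dist P P <= 0.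
Proof.
rewrite -[leRHS]addr0 -[X in _ + X](@enorm0 R n) -[X in enorm X](subrr (offset P)).
by apply: plane_dist_le => // x _; rewrite subrr enorm0.
Qed.

Lemma offset_orthoproj P y : plane_points P y ->
  offset P = y - orthoproj (dir P) y.
Proof.
move=> [v /= vV vy]; have [pV pO] := orthoprojP (dir P) y.
have yv : y - v = offset P by rewrite -vy addrAC subrr add0r.
rewrite (_ : orthoproj _ y = v) ?yv//; apply: orthoproj_unique pV pO vV _ => w wV.
by rewrite yv offset_ortho.
Qed.

(** A frame of length [k] spans the direction, so projections onto the directions are frame
    projections. They differ by at most [2 * k * delta] on unit vectors; the offsets are the
    residuals of the base points and differ by at most [(1 + k + 2 * M * k) * delta]. *)
Lemma frame_state_plane_dist c (F : seq nat) (M delta : R) y e i i' :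
  0 <= M -> 0 <= delta -> frame_state c F M k delta y e -> i \in F -> i' \in F ->
  plane_dist (c i : affine_plane R n k) (c i') <= (3 * k%:R + 1 + 2 * M * k%:R) * delta.
Proof.
move=> M0 d0 [yF eF close] iF iF'.
have [yP yM] := yF _ iF; have [yP' yM'] := yF _ iF'.
have [ei eV] := eF _ iF; have [ei' eV'] := eF _ iF'.
have [yy ee] := close _ _ iF iF'.
have proj x x' : enorm (orthoproj (dir (c i)) x - orthoproj (dir (c i')) x') <=
    k%:R * (enorm (x - x') + 2 * enorm x' * delta).
  rewrite (orthoproj_frame x ei eV (dim_dir _)).
  rewrite (orthoproj_frame x' ei' eV' (dim_dir _)).
  exact: frame_proj_close.
apply: (@le_trans _ _ (2 * k%:R * delta + enorm (offset (c i) - offset (c i')))).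
  apply: plane_dist_le => [|x x1]; first by rewrite !mulr_ge0.
  by rewrite (le_trans (proj x x))// subrr enorm0 add0r x1 mulr1 mulrCA mulrA.
rewrite (offset_orthoproj yP) (offset_orthoproj yP').
have -> : y i - orthoproj (dir (c i)) (y i) - (y i' - orthoproj (dir (c i')) (y i')) =
    (y i - y i') - (orthoproj (dir (c i)) (y i) - orthoproj (dir (c i')) (y i')).
  by rewrite !opprB addrACA [RHS]addrACA; congr (_ + _); rewrite addrC.
have h := le_trans (ler_enormB _ _) (lerD yy (proj (y i) (y i'))).
apply: (le_trans (lerD (lexx _) h)).
have k0 : 0 <= k%:R :> R by [].
have h1 : k%:R * enorm (y i - y i') <= k%:R * delta by rewrite ler_wpM2l.
have h2 : k%:R * (enorm (y i') * delta) <= k%:R * (M * delta).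
  by rewrite ler_wpM2l// ler_wpM2r.
lra.
Qed.

(** The base point and the first [m] frame vectors come from the first slot, the other [k - m] from
    the second. Each pick costs a factor [eps^(a1 - b1)] or [eps^(a2 - b2)], and full frames that
    agree force planes closer than the separation, so at most one plane survives. *)
Lemma slots_separated_bound A Q1 Q2 (M a1 b1 g1 a2 b2 g2 : R) (m : nat) :
  0 <= M -> (m <= k)%N -> 0 < b1 -> m%:R < b1 + 1 -> k%:R < b2 + 1 ->
  0 < g1 -> 0 < g2 -> slot A Q1 M a1 b1 g1 -> slot A Q2 M a2 b2 g2 ->
  separated_bound (@plane_dist R n k)
    ((m%:R + 1) * (a1 - b1) + (k%:R - m%:R) * (a2 - b2)) A.
Proof.
move=> M0 mk b10 mb1 kb2 g10 g20 sl1 sl2.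
have [L [e0 [L0 e00 ini]]] := frame_init b10 g10 sl1.
have [K1 K10 adv1] :=
  @frame_steps R n k A Q1 M a1 b1 g1 0 m 2 M0 mb1 g10 (ler0n _ _) sl1.
have [|K2 K20 adv2] :=
  @frame_steps R n k A Q2 M a2 b2 g2 m (k - m) K1 M0 _ g20 K10 sl2.
  by rewrite subnKC.
rewrite subnKC// natrB// in adv2; rewrite add0n in adv1.
have [L' [e0' [L0' e00' adv]]] := advance_trans adv1 adv2.
(* The final frames give distance at most [(Kd - 1) * eps]; the added 1 makes [Kd] positive, so that
   [eps = r / Kd] makes sense. *)
pose Kd := (3 * k%:R + 1 + 2 * M * k%:R) * K2 + 1.
have Kd0 : 0 < Kd.
  by rewrite ltr_wpDl// mulr_ge0// !addr_ge0// !mulr_ge0.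
set x := _ + _.
exists (L' * L * Kd `^ x), (Kd * Num.min e0 e0'); split.
- by rewrite !mulr_gt0// powR_gt0.
- by rewrite mulr_gt0// lt_min e00.
move=> r /andP[r0 re] c F Fu FA sep; pose eps := r / Kd.
have eps0 : 0 < eps by rewrite divr_gt0.
have : eps <= Num.min e0 e0' by rewrite ler_pdivrMr// mulrC.
rewrite le_min => /andP[epse epse'].
have [|F1 [y1 [e1 [F1u F1F st1 F1s]]]] := ini eps _ c F Fu FA; first by rewrite eps0.
have [||F2 [y2 [e2 [F2u F2F st2 F2s]]]] := adv eps _ c F1 y1 e1 F1u _ st1.
- by rewrite eps0.
- by move=> i /F1F/FA.
have F2size : (size F2 <= 1)%N.
  case: F2 F2u F2F st2 {F2s} => [//|i [//|i' F2]] /= /andP[+ _] F2F st2.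
  rewrite inE negb_or => /andP[ii' _].
  have iF : i \in [:: i, i' & F2] by rewrite mem_head.
  have iF' : i' \in [:: i, i' & F2] by rewrite !inE eqxx orbT.
  have := sep _ _ (F1F _ (F2F _ iF)) (F1F _ (F2F _ iF')) ii'.
  rewrite ltNge => /negP; case.
  have K2e : 0 <= K2 * eps by rewrite mulr_ge0// ltW.
  apply: (le_trans (frame_state_plane_dist M0 K2e st2 iF iF')).
  have -> : r = Kd * eps by rewrite mulrC divfK// gt_eqF.
  by rewrite mulrA ler_wpM2r ?(ltW eps0)// lerDl.
have F2R : (size F2)%:R <= 1 :> R by rewrite -[1]/(1%:R) ler_nat.
have xE : x = (a1 - b1) + (m%:R * (a1 - b1) + (k%:R - m%:R) * (a2 - b2)).
  by rewrite /x; ring.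
have : (size F)%:R * eps `^ x <= L' * L.
  rewrite {1}xE powRD; last by rewrite (gt_eqF eps0) implybT.
  rewrite mulrA; apply: (le_trans (ler_wpM2r (powR_ge0 _ _) F1s)).
  rewrite [L' * L]mulrC -[leLHS]mulrA ler_pM2l// (le_trans F2s)//.
  by rewrite ler_piMr// ltW.
rewrite -ler_pdivlMr ?powR_gt0// => h; apply: (le_trans h).
rewrite -powRN /eps powRM ?invr_ge0 ?(ltW r0) ?(ltW Kd0)//.
rewrite -[Kd^-1]powR_inv1 ?(ltW Kd0)// -powRrM mulN1r opprK.
by rewrite [r `^ _ * _]mulrC mulrA.
Qed.

(* Otherwise the frame construction would produce [k + 1] orthonormal vectors in
   a [k]-dimensional direction. *)
Lemma bounded_content_plane_eq0 P (S : set 'rV[R]_n) (M b : R) :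
  k%:R < b -> S `<=` plane_points P -> S `<=` [set x | enorm x <= M] ->
  hausdorff_content euclidean_dist b 1 S = 0%E.
Proof.
move=> kb SP SM; apply/eqP; rewrite eq_le content_ge0 andbT leNgt; apply/negP => S0.
have b0 : 0 < b by apply: le_lt_trans kb; rewrite ler0n.
have [g g0 gS] : exists2 g : R, 0 < g &
    (g%:E <= hausdorff_content euclidean_dist b 1 S)%E.
  move: S0; case: (hausdorff_content _ _ _ _) => [g| |] //.
    by rewrite lte_fin => g0; exists g.
  by exists 1 => //; rewrite leey.
have MS0 : 0 <= `|M| by [].
(* The frame construction is run on the family consisting of [P] alone. *)
have sl : slot [set P] (fun=> S) `|M| n%:R b g.
  exists [set x | enorm x <= `|M|]; first exact: ball_has_nets.
  have SM' : S `<=` [set x | enorm x <= `|M|].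
    by move=> x /SM /= h; rewrite (le_trans h)// ler_norm.
  by move=> _ ->; split.
have [L [e0 [L0 e00 ini]]] := frame_init b0 g0 sl.
have [|K' K'0 [L' [e0' [L0' e00' adv]]]] :=
    @frame_steps R n k _ _ _ _ b g 0 k.+1 2 MS0 _ g0 (ler0n _ _) sl.
  by rewrite add0n -natr1 ltrD2r.
pose eps := Num.min e0 e0'; have eps0 : 0 < eps by rewrite lt_min e00.
have F0 : uniq [:: 0%N] by [].
have [||F1 [y1 [e1 [F1u _ st1 F1s]]]] := ini eps _ (fun=> P) [:: 0%N] F0.
- by rewrite eps0 ge_min lexx.
- by [].
have [||F2 [y2 [e2 [F2u _ [_ st2 _] F2s]]]] := adv eps _ (fun=> P) F1 y1 e1 F1u _ st1.
- by rewrite eps0 ge_min lexx orbT.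
- by [].
(* Each selection keeps a positive proportion, so the single plane is never lost. *)
have : 0 < (size F1)%:R :> R.
  by rewrite -(pmulr_rgt0 _ L0) (lt_le_trans _ F1s)// mulr_gt0// powR_gt0.
move=> F10; have : 0 < (size F2)%:R :> R.
  by rewrite -(pmulr_rgt0 _ L0') (lt_le_trans _ F2s)// mulr_gt0// powR_gt0.
case: F2 {F2u F2s} st2 => [|i F2] st2; first by rewrite ltxx.
have [ei eV] := st2 i (mem_head _ _).
by have := orthonormal_dim ei eV; rewrite add0n dim_dir ltnn.
Qed.

(** Some bounded part of [S] has positive content, by countable subadditivity. Raising [l] enlarges
    the part and lowers the threshold, so all large [l] work, and two sets can share one [l]. *)
Lemma content_exhaust (b : R) (S : set 'rV[R]_n) :
  hausdorff_content euclidean_dist b 1 S <> 0%E ->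
  exists N : nat, forall l, (N <= l)%N ->
    ((l.+1%:R^-1)%:E <= hausdorff_content euclidean_dist b 1
       (S `&` [set x | (enorm x <= l%:R)%R]))%E.
Proof.
move=> S0; have [N SN] : exists N : nat, hausdorff_content euclidean_dist b 1
    (S `&` [set x | enorm x <= N%:R]) <> 0%E.
  apply: contrapT => no; apply: S0.
  have -> : S = \bigcup_N (S `&` [set x | enorm x <= N%:R]).
    apply/seteqP; split=> [x Sx|x [N _ []//]].
    exists (Num.truncn (enorm x)).+1 => //; split=> //=.
    exact/ltW/truncnS_gt.
  apply: content0_bigcup => N; apply: contrapT => SN; apply: no.
  by exists N.
have [g g0 gS] : exists2 g : R, 0 < g & (g%:E <= hausdorff_content euclidean_dist b 1
    (S `&` [set x | (enorm x <= N%:R)%R]))%E.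
  move: (@content_ge0 R _ euclidean_dist b 1 (S `&` [set x | enorm x <= N%:R])) SN.
  case: (hausdorff_content _ _ _ _) => [g| |] //.
    rewrite lee_fin le_eqVlt => /predU1P[<- //|g0 _].
    by exists g.
  by exists 1 => //; rewrite leey.
exists (maxn N (Num.truncn g^-1)) => l; rewrite geq_max => /andP[Nl gl].
apply: (@le_trans _ _ g%:E).
  rewrite lee_fin invf_ple ?posrE ?ltr0n//.
  apply/ltW; apply: (lt_le_trans (truncnS_gt _)).
  by rewrite ler_nat ltnS.
apply: (le_trans gS); apply: content_mono => x [Sx /= xN]; split=> //=.
by rewrite (le_trans xN)// ler_nat.
Qed.

End PlaneFamilies.

(** * Countable decomposition and the final bound *)

Lemma affine_plane_inhabited (R : realType) (n k : nat) :
  (k <= n)%N -> exists P : affine_plane R n k, True.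
Proof.
move=> kn; pose b := vbasis {:'rV[R]_n}.
have /eqnP/= freek : free (take k b).
  have := basis_free (vbasisP {:'rV[R]_n}).
  by rewrite -[X in free X](cat_take_drop k); exact: catl_free.
have dimk : \dim <<take k b>> = k.
  rewrite freek size_take size_tuple dimvf dim_matrix mul1r.
  by case: ltngtP kn.
by have [P _] := plane_points_exists 0 dimk; exists P.
Qed.

(** Formulated for every natural [m] with [m < s + 1], which covers both [m = ceil s] and the case
    [m = s = k] of whole planes. *)
Lemma packing_dim_union_parts (R : realType) (n k : nat)
    (Ps : set (affine_plane R n k)) (t : R) (m : nat) (s : R)
    (part : affine_plane R n k -> set 'rV[R]_n) :
  (1 <= k)%N -> (k <= n)%N -> 0 < t -> packing_dim plane_dist Ps = t%:E ->
  0 < s -> m%:R < s + 1 ->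
  (forall P, Ps P -> part P `<=` plane_points P) ->
  (forall P, Ps P -> (s%:E <= hausdorff_dim euclidean_dist (part P))%E) ->
  ((s + (t - (k%:R - m%:R) * (n%:R - k%:R)) / (m%:R + 1))%:E
    <= packing_dim euclidean_dist (\bigcup_(P in Ps) part P))%E.
Proof.
move=> k_ge1 k_le_n t_gt0 dim_Ps s0 ms sub_part dim_part; rewrite leNgt; apply/negP.
move=> /ereal_inf_lt[_ [a [a0 Fa] <-]]; rewrite lte_fin => a_lt.
have [P0 _] := @affine_plane_inhabited R n k k_le_n.
have [Ps0|/set0P[P1 PsP1]] := eqVneq Ps set0.
  have : (packing_dim plane_dist Ps <= (t / 2)%:E)%E.
    apply: (@packing_dim_le_separated R _ plane_dist P0 0 _ _ (fun=> set0)).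
    - exact: plane_dist_refl.
    - by rewrite divr_gt0.
    - by rewrite divr_gt0.
    - by rewrite Ps0.
    - move=> _; exists 1, 1; split=> // r _ c F _ F0 _.
      case: F F0 => [_|i F F0]; first by rewrite mul1r powR_ge0.
      by case: (F0 i); rewrite mem_head.
  by rewrite dim_Ps lee_fin leNgt => /negP; apply; lra.
have part_neq0 P b : Ps P -> 0 < b < s ->
    hausdorff_content euclidean_dist b 1 (part P) <> 0%E.
  by move=> PsP; apply: hausdorff_dim_content; exact: dim_part.
(* Otherwise a part would have nonzero content for some [b] above [k], whereas bounded subsets of a
   plane have none. *)
have sk : s <= k%:R.
  rewrite leNgt; apply/negP => ks; pose b := (k%:R + s) / 2.
  have kb : k%:R < b by rewrite /b; lra.
  have bs : 0 < b < s.
    by rewrite (le_lt_trans (ler0n _ _) kb)/= /b; lra.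
  have [N /(_ N (leqnn N))] := content_exhaust (part_neq0 _ _ PsP1 bs).
  have -> := @bounded_content_plane_eq0 R n k P1
    (part P1 `&` [set x | enorm x <= N%:R]) N%:R b kb.
  - by rewrite lee_fin leNgt invr_gt0 ltr0n.
  - by move=> x [/(sub_part _ PsP1)].
  - by move=> x [].
have mk : (m <= k)%N by rewrite -ltnS -(ltr_nat R) -natr1 (lt_le_trans ms)// lerD2r.
have k1 : 1 <= k%:R :> R by rewrite ler1n.
have m10 : 0 < m%:R + 1 :> R by rewrite natr1 ltr0n.
(* The distance from [t] to the exponent in the limit case [b1 = s], [b2 = k]. *)
pose gap := t - ((m%:R + 1) * (a - s) + (k%:R - m%:R) * (n%:R - k%:R)).
have gap0 : 0 < gap.
  move: a_lt; rewrite -ltrBlDl ltr_pdivlMr// => h; rewrite /gap; lra.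
(* Lowering [s] and [k] by [th] raises the exponent by [(k + 1) * th], at most half of [gap]. The
   other bounds ensure [0 < b1], [m < b1 + 1], [k < b2 + 1] and [0 < b2]. *)
pose th := Num.min (gap / (2 * (k%:R + 1)))
  (Num.min (s / 2) (Num.min ((s + 1 - m%:R) / 2) (2^-1))).
have k10 : 0 < 2 * (k%:R + 1) :> R by lra.
have th0 : 0 < th.
  by rewrite !lt_min !divr_gt0//= ?invr_gt0 ?ltr0n ?subr_gt0.
have [th1 th2 th3 th4] : [/\ (2 * (k%:R + 1)) * th <= gap, th <= s / 2,
    th <= (s + 1 - m%:R) / 2 & th <= 2^-1].
  split; rewrite /th ?ge_min ?lexx ?orbT//.
  by rewrite mulrC -ler_pdivlMr// ge_min lexx.
have [E FE netE] := packing_measure0_nets a0 Fa.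
pose b1 := s - th; pose b2 := k%:R - th.
pose t1 := (m%:R + 1) * (a - b1) + (k%:R - m%:R) * (n%:R - b2).
have t1t : t1 < t by move: gap0 th1; rewrite /t1 /b1 /b2 /gap => ? ?; nra.
(* The maximum with 0 is taken because [t1] may be negative while the packing dimension only admits
   positive exponents. *)
pose t2 := (Num.max t1 0 + t) / 2.
have mx1 : t1 <= Num.max t1 0 by rewrite le_max lexx.
have mx2 : 0 <= Num.max t1 0 by rewrite le_max lexx orbT.
have mxt : Num.max t1 0 < t by rewrite gt_max t1t.
suff : (packing_dim plane_dist Ps <= t2%:E)%E.
  by rewrite dim_Ps lee_fin leNgt => /negP; apply; rewrite /t2; lra.
have /card_esym/ppcard_eqP[f] := card_nat2.
pose B l := [set x : 'rV[R]_n | enorm x <= l%:R].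
(* The index [i] selects a member of the cover of the union; [l] gives both the radius of the ball
   and the common lower bound [1 / (l + 1)] for the two contents. *)
pose A i l := [set P | Ps P /\
  ((l.+1%:R^-1)%:E <=
     hausdorff_content euclidean_dist b1 1 (part P `&` E i `&` B l))%E /\
  ((l.+1%:R^-1)%:E <=
     hausdorff_content euclidean_dist b2 1 (plane_points P `&` B l))%E].
apply: (@packing_dim_le_separated R _ plane_dist P0 t1 _ _
  (fun i => A (f i).1 (f i).2)).
- exact: plane_dist_refl.
- by rewrite /t2; lra.
- by rewrite /t2; lra.
- move=> P PsP.
  have b1s : 0 < b1 < s by rewrite /b1; apply/andP; split; lra.
  have [i Ei] : exists i, hausdorff_content euclidean_dist b1 1 (part P `&` E i) <> 0%E.
    apply: contrapT => no; apply: (part_neq0 _ _ PsP b1s).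
    rewrite (_ : part P = \bigcup_i (part P `&` E i)).
      by apply: content0_bigcup => i; apply: contrapT => Ei; apply: no; exists i.
    apply/seteqP; split=> [x Px|x [i _ []//]].
    by have [i _ Ei] := FE x (bigcup_sup PsP Px); exists i.
  have [N1 h1] := content_exhaust Ei.
  have [|N2 h2] := content_exhaust (@plane_points_content_neq0 _ _ _ P b2 _).
    by rewrite /b2; apply/andP; split; lra.
  exists (f^-1%FUN (i, maxn N1 N2)) => //; rewrite invK ?inE//=; split=> //; split.
    by apply: h1; rewrite leq_maxl.
  by apply: h2; rewrite leq_maxr.
- move=> q; move: (f q) => [i l] /=.
  have l0 : 0 < l.+1%:R^-1 :> R by rewrite invr_gt0 ltr0n.
  apply: (@slots_separated_bound R n k _ (fun P => part P `&` E i `&` B l)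
    (fun P => plane_points P `&` B l) l%:R _ _ l.+1%:R^-1 _ _ l.+1%:R^-1) => //.
  + by rewrite /b1; lra.
  + by rewrite /b1; lra.
  + by rewrite /b2; lra.
  + exists (E i) => // P [PsP [h _]]; split=> //.
    * by move=> x [[]].
    * by move=> x [[/(sub_part _ PsP)]].
  + exists (B l); first exact: ball_has_nets.
    by move=> P [_ [_ h]]; split=> //; move=> x [].
Qed.

(** The measure dominates the content at scale 1, which is nonzero for every positive exponent up to
    [k]. *)
Lemma plane_points_hausdorff_dim (R : realType) (n k : nat) (P : affine_plane R n k) :
  (k%:R%:E <= hausdorff_dim euclidean_dist (plane_points P))%E.
Proof.
apply: le_ereal_inf_tmp => _ [s [s0 Hs] <-]; rewrite lee_fin leNgt; apply/negP => sk.
have [|] := @plane_points_content_neq0 R n k P s; first by rewrite s0 ltW.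
apply/eqP; rewrite eq_le content_ge0 andbT -Hs.
by apply: ereal_sup_ubound; exists 1 => //=; exact: ltr01.
Qed.

Unset Implicit Arguments.

Theorem theorem1 (R : realType) (n k : nat) (k_ge1 : (1 <= k)%N)
    (k_le_n : (k <= n)%N) (Ps : set (affine_plane R n k)) (t : R)
    (t_gt0 : 0 < t) (dim_Ps : packing_dim plane_dist Ps = t%:E) :
  (forall (s : R) (part : affine_plane R n k -> set 'rV[R]_n),
     0 < s ->
     (forall P, Ps P -> part P `<=` plane_points P) ->
     (forall P, Ps P -> (s%:E <= hausdorff_dim euclidean_dist (part P))%E) ->
     ((s + (t - (k%:R - (Num.ceil s)%:~R) * (n%:R - k%:R))
             / ((Num.ceil s)%:~R + 1))%:E
       <= packing_dim euclidean_dist (\bigcup_(P in Ps) part P))%E)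
  /\
  ((t / (k%:R + 1) + k%:R)%:E
     <= packing_dim euclidean_dist (\bigcup_(P in Ps) plane_points P))%E.
Proof.
split=> [s part s0 sub_part dim_part|].
  (* As [s] is positive, its ceiling is a natural number. *)
  have cE : (Num.ceil s)%:~R = `|Num.ceil s|%:R :> R.
    by rewrite natr_absz gtr0_norm ?ceil_gt0.
  rewrite cE; apply: packing_dim_union_parts => //.
  by rewrite -cE -ltrBlDr -[1]/(1%:~R) -intrB ceilB1_lt.
have k0 : 0 < k%:R :> R by rewrite ltr0n.
(* Taking [m = k] and [s = k] makes the term [(k - m) * (n - k)] vanish. *)
have := @packing_dim_union_parts R n k Ps t k k%:R plane_points k_ge1 k_le_n
  t_gt0 dim_Ps k0.
rewrite subrr mul0r subr0 [k%:R + t / _]addrC; apply=> [|P _|P _].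
- by rewrite ltrDl.
- exact: subset_refl.
- exact: plane_points_hausdorff_dim.
Qed.
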